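(* Let $\mathcal{O}$ be an operad of graded $R$-modules with an $A_\infty$-multiplication. Then the Hochschild complex $S\mathfrak{s}\mathrm{End}_{S\mathfrak{s}\mathcal{O}}$ has a structure of a $J$-algebra. In the form for an arbitrary $A_\infty$-algebra: if $A$ is an $A_\infty$-algebra, then its Hochschild complex $S\mathfrak{s}\mathrm{End}_A$ is a $J$-algebra.
   Context: $R$ is a commutative ring. Graded $R$-modules are cohomologically graded, with the Koszul sign rule. Operads are non-symmetric. $\mathrm{End}_A(n)=\mathrm{Hom}(A^{\otimes n},A)$. $S$ is the shift, $S:A\to SA$ of degree $1$ being the identity. Operadic suspension: for an operad $\mathcal{P}$ of graded modules, $\mathfrak{s}\mathcal{P}(n)=\mathcal{P}(n)\otimes\Lambda(n)$, where $\Lambda(n)=S^{n-1}R$ has generator $e^n$ in degree $n-1$ and $e^n\circ_ie^m=(-1)^{(n-i)(m-1)}e^{n+m-1}$. Explicitly $x\tilde\circ_{r+1}y=(-1)^{(n-1)\deg(y)+(n-1)(m-1)+r(m-1)}x\circ_{r+1}y$ for $x\in\mathcal{P}(n)$, $y\in\mathcal{P}(m)$; write $\tilde\gamma$ for the composition of $\mathfrak{s}\mathcal{P}$. Also $\mathfrak{s}\mathcal{P}$ denotes the graded module $\prod_n\mathfrak{s}\mathcal{P}(n)$ with natural degree $|x|=n+\deg(x)-1$. Put $x\tilde\circ y=\sum_ix\tilde\circ_iy$. Braces on $\mathfrak{s}\mathcal{P}$: $b_0(x)=x$, $b_n(x;x_1,\dots,x_n)=\sum\tilde\gamma(x;1,\dots,1,x_1,1,\dots,1,x_n,1,\dots,1)$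 over all order-preserving insertions (zero if $n$ exceeds the arity of $x$). A brace algebra is a graded module $B$ with maps $b_n:B^{\otimes1+n}\to B$ satisfying the brace relation $b_m(b_n(x;x_1,\dots,x_n);y_1,\dots,y_m)=\sum(-1)^{\varepsilon}b_l(x;y_1,\dots,y_{i_1},b_{j_1}(x_1;y_{i_1+1},\dots,y_{i_1+j_1}),\dots,b_{j_n}(x_n;y_{i_n+1},\dots,y_{i_n+j_n}),\dots,y_m)$, summed over all order-preserving choices of $i_1,\dots,i_n,j_1,\dots,j_n$, where $l$ is the number of entries after the semicolon and $\varepsilon=\sum_p|x_p|\sum_{q=1}^{i_p}|y_q|$. An $A_\infty$-algebra is a graded module $A$ with maps $m_j:A^{\otimes j}\to A$ of degree $2-j$, $j\ge1$, with $\sum_{r+q+t=v}(-1)^{rq+t}m_{r+1+t}(1^{\otimes r}\otimes m_q\otimes1^{\otimes t})=0$ for all $v\ge1$. An $A_\infty$-multiplication on $\mathcal{O}$ is a map of operads $\mathcal{A}_\infty\to\mathcal{O}$ (with $\mathcal{A}_\infty$ the operad of $A_\infty$-algebras), equivalently $m\in\mathfrak{s}\mathcal{O}$ of natural degree $1$ concentrated in positive arity with $m\tilde\circ m=0$. It induces on $S\mathfrak{s}\mathcal{O}$ the $A_\infty$-structure $M_j=S\circ M'_j\circ(S^{\otimes j})^{-1}$, where $M'_1(x)=b_1(m;x)-(-1)^{|x|}b_1(x;m)$ and $M'_j(x_1,\dots,x_j)=b_j(m;x_1,\dots,x_j)$ for $j>1$. An $A_\infty$-algebra $A$ is an $A_\infty$-multiplication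 $m=m_1+m_2+\cdots\in\mathfrak{s}\mathrm{End}_A$ on $\mathrm{End}_A$, so $S\mathfrak{s}\mathrm{End}_A$ carries this $A_\infty$-structure (take $\mathcal{O}=\mathrm{End}_A$), and $\mathfrak{s}\mathrm{End}_A$ carries the braces above. The Hochschild complex of $A$ is $S\mathfrak{s}\mathrm{End}_A$. A $J$-algebra $V$ is an $A_\infty$-algebra with structure maps $\{M_j\}_{j\ge1}$ such that the shift $S^{-1}V$ is a brace algebra with braces $b_n$, and such that the following compatibility relations hold for all $x,x_1,\dots,x_j,y_1,\dots,y_n\in S^{-1}V$ (degrees $|\cdot|$ taken in $S^{-1}V$). (1) For $n\ge0$: $$(-1)^{\sum_{i=1}^n(n-i)|y_i|}Sb_n(S^{-1}M_1(Sx);y_1,\dots,y_n)=\sum_{\substack{l+k-1=n\\1\le i_1\le n-k+1}}(-1)^{\varepsilon}M_l(Sy_1,\dots,Sb_k(x;y_{i_1},\dots),\dots,Sy_n)$$ $$-(-1)^{|x|}\sum_{\substack{l+k-1=n\\1\le i_1\le n-k+1}}(-1)^{\eta}Sb_k(x;y_1,\dots,S^{-1}M_l(Sy_{i_1},\dots),\dots,y_n),$$ where $\varepsilon=\sum_{v=1}^{i_1-1}|y_v|(|x|-k+1)+\sum_{v=1}^k|y_{i_1+v-1}|(k-v)+(l-i_1)|x|$ and $\eta=\sum_{v=1}^{i_1-1}(k-v)|y_v|+\sum_{v=1}^{i_1-1}l|y_v|+\sum_{v=i_1}^{i_1+l-1}(k-i_1)|y_v|+\sum_{v=i_1}^{n-l}(k-v)|y_{v+l}|$.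 (2) For $j>1$: $$(-1)^{\sum_{i=1}^n(n-i)|y_i|}Sb_n(S^{-1}M_j(Sx_1,\dots,Sx_j);y_1,\dots,y_n)=\sum(-1)^{\varepsilon}M_l(Sy_1,\dots,Sb_{k_1}(x_1;y_{i_1},\dots),\dots,Sb_{k_j}(x_j;y_{i_j},\dots),\dots,Sy_n).$$ The unindexed sum runs over all choices of non-negative integers with $l+k_1+\cdots+k_j-j=n$ and over all order-preserving insertions ($b_{k_t}(x_t;\dots)$ takes the $k_t$ consecutive arguments starting at $y_{i_t}$), and (writing $w$ for a summation index) $\varepsilon=\sum_{1\le t\le j}\sum_{1\le v\le k_t}|y_{i_t+v-1}|(k_t-v)+\sum_{1\le v<w\le j}k_v|x_w|+\sum_{1\le v\le w\le j}|x_v|(i_{w+1}-i_w-k_w)+\sum_{0\le t<w\le j}\sum_{i_t\le v<i_{t+1}}(|y_v|+1)(|x_w|-k_w+1)+\sum_{0\le v<w\le j}(i_{v+1}-i_v-k_v)(|x_w|-k_w+1)$, where $i_0=0$ and $i_{j+1}=n+1$ (the symbols $k_0$ and $|y_0|$ occurring here are read as $0$).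
   Formalization: As printed the J-relations fail (A = Z, m_2 the product). Corrected: in η's last sum, k-v becomes k-v-1; in ε of (2), k_v|x_w| becomes k_v(|x_w|-k_w+1); in the second sum of (1), the bound i_1 ≤ n-k+1 becomes i_1 ≤ n-l+1. *)

(* Defs.v *)
From HB Require Import structures.
From mathcomp Require Import all_boot all_order all_algebra.
From mathcomp Require Import boolp zify ring.

Set Implicit Arguments.
Unset Strict Implicit.
Unset Printing Implicit Defensive.

Import Order.TTheory GRing.Theory Num.Theory.
Local Open Scope ring_scope.

Definition dprod (R : comPzRingType) (T : Type) (V : T -> lmodType R) : Type :=
  forall t : T, V t.

Lemma dprod_addA (R : comPzRingType) (T : Type) (V : T -> lmodType R) :
  associative (fun (f g : dprod V) t => f t + g t).
Proof. by move=> f g h; apply: functional_extensionality_dep => t; rewrite addrA. Qed.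

Lemma dprod_addC (R : comPzRingType) (T : Type) (V : T -> lmodType R) :
  commutative (fun (f g : dprod V) t => f t + g t).
Proof. by move=> f g; apply: functional_extensionality_dep => t; rewrite addrC. Qed.

Lemma dprod_add0 (R : comPzRingType) (T : Type) (V : T -> lmodType R) :
  left_id (fun t => 0 : V t) (fun (f g : dprod V) t => f t + g t).
Proof. by move=> f; apply: functional_extensionality_dep => t; rewrite add0r. Qed.

Lemma dprod_addN (R : comPzRingType) (T : Type) (V : T -> lmodType R) :
  left_inverse (fun t => 0 : V t) (fun (f : dprod V) t => - f t)
    (fun (f g : dprod V) t => f t + g t).
Proof. by move=> f; apply: functional_extensionality_dep => t; rewrite addNr. Qed.

HB.instance Definition _ (R : comPzRingType) (T : Type) (V : T -> lmodType R) :=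
  gen_eqMixin (dprod V).
HB.instance Definition _ (R : comPzRingType) (T : Type) (V : T -> lmodType R) :=
  gen_choiceMixin (dprod V).
HB.instance Definition _ (R : comPzRingType) (T : Type) (V : T -> lmodType R) :=
  GRing.isZmodule.Build (dprod V)
    (@dprod_addA R T V) (@dprod_addC R T V) (@dprod_add0 R T V) (@dprod_addN R T V).

Definition dprod_scale (R : comPzRingType) (T : Type) (V : T -> lmodType R)
  (a : R) (f : dprod V) : dprod V := fun t => a *: f t.

Lemma dprod_scaleA (R : comPzRingType) (T : Type) (V : T -> lmodType R)
  (a b : R) (f : dprod V) :
  dprod_scale a (dprod_scale b f) = dprod_scale (a * b) f.
Proof. by apply: functional_extensionality_dep => t; apply: scalerA. Qed.

Lemma dprod_scale1 (R : comPzRingType) (T : Type) (V : T -> lmodType R) :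
  left_id 1 (@dprod_scale R T V).
Proof. by move=> f; apply: functional_extensionality_dep => t; apply: scale1r. Qed.

Lemma dprod_scaleDr (R : comPzRingType) (T : Type) (V : T -> lmodType R) :
  right_distributive (@dprod_scale R T V) +%R.
Proof. by move=> a f g; apply: functional_extensionality_dep => t; apply: scalerDr. Qed.

Lemma dprod_scaleDl (R : comPzRingType) (T : Type) (V : T -> lmodType R)
  (f : dprod V) : {morph (@dprod_scale R T V)^~ f : a b / a + b}.
Proof. by move=> a b; apply: functional_extensionality_dep => t; apply: scalerDl. Qed.

HB.instance Definition _ (R : comPzRingType) (T : Type) (V : T -> lmodType R) :=
  GRing.Zmodule_isLmodule.Build R (dprod V)
    (@dprod_scaleA R T V) (@dprod_scale1 R T V)
    (@dprod_scaleDr R T V) (@dprod_scaleDl R T V).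

Lemma dprod_zeroE (R : comPzRingType) (T : Type) (V : T -> lmodType R) t :
  (0 : dprod V) t = 0.
Proof. by []. Qed.

Lemma dprod_linE (R : comPzRingType) (T : Type) (V : T -> lmodType R)
  (a : R) (f g : dprod V) t : (a *: f + g) t = a *: f t + g t.
Proof. by []. Qed.

Definition sgn (R : comPzRingType) (z : int) : R := (-1) ^+ `|z|%N.

(* The component in degree i of a homogeneous element x of the graded object
   V: it is x itself (transported along tag x = i) if x has degree i, and 0
   otherwise.  All identities between elements whose degrees agree only
   propositionally are stated in a common V i through part. *)
Definition part (R : comPzRingType) (I : eqType) (V : I -> lmodType R) (i : I)
  (x : {i : I & V i}) : V i := @untag I (fun j => V j) (V i) 0 i id x.

Definition gmod (R : comPzRingType) := int -> lmodType R.

Definition hel (R : comPzRingType) (A : gmod R) : Type := {d : int & A d}.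

Notation dpart d x := (@part _ int _ d x).

Definition sdeg (R : comPzRingType) (A : gmod R) (xs : seq (hel A)) : int :=
  \sum_(x <- xs) tag x.

(* SA is A shifted so that S : A -> SA has degree 1. *)
Definition gshift (R : comPzRingType) (A : gmod R) : gmod R := fun d => A (d - 1).

Definition shS (R : comPzRingType) (A : gmod R) (x : hel A) : hel (gshift A) :=
  Tagged (gshift A) (i := tag x + 1)
    (ecast d (A d) (esym (addrK 1 (tag x))) (tagged x)).

Definition shSinv (R : comPzRingType) (A : gmod R) (x : hel (gshift A)) : hel A :=
  Tagged A (i := tag x - 1) (tagged x).

Notation multifun A k := (dprod (fun xs : seq (hel A) => A (k + sdeg xs))).

Definition happ (R : comPzRingType) (A : gmod R) (k : int)
  (f : multifun A k) (xs : seq (hel A)) : hel A :=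
  Tagged A (f xs).

(* A graded map A^{(x) n} -> A of degree k is given by its values on lists of n
   homogeneous elements, on which it is R-multilinear; to have a single function
   type for all n it is extended by 0 to the lists of other lengths. *)
Definition multilinear (R : comPzRingType) (A : gmod R) (n : nat) (k : int)
  (f : multifun A k) : Prop :=
  (forall xs, size xs != n -> f xs = 0) /\
  (forall s1 s2 d (a : R) (u v : A d) e,
     dpart e (happ f (s1 ++ Tagged A (a *: u + v) :: s2)) =
     a *: dpart e (happ f (s1 ++ Tagged A u :: s2)) +
     dpart e (happ f (s1 ++ Tagged A v :: s2))).

Definition multilinearb (R : comPzRingType) (A : gmod R) (n : nat) (k : int) :
  {pred multifun A k} := fun f => `[< multilinear n f >].

Record ghom (R : comPzRingType) (A : gmod R) (n : nat) (k : int) := GHom {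
  hom_val :> multifun A k;
  hom_subproof : multilinearb n hom_val }.

Definition hom_fun (R : comPzRingType) (A : gmod R) n k (f : ghom A n k) :
  forall xs : seq (hel A), A (k + sdeg xs) := hom_val f.
Coercion hom_fun : ghom >-> Funclass.

HB.instance Definition _ (R : comPzRingType) (A : gmod R) (n : nat) (k : int) :=
  [isSub for @hom_val R A n k].
HB.instance Definition _ (R : comPzRingType) (A : gmod R) (n : nat) (k : int) :=
  gen_eqMixin (ghom A n k).
HB.instance Definition _ (R : comPzRingType) (A : gmod R) (n : nat) (k : int) :=
  gen_choiceMixin (ghom A n k).

Lemma partE (R : comPzRingType) (I : eqType) (V : I -> lmodType R) i (x : V i) :
  part i (Tagged V x) = x.
Proof. by rewrite /part (@untagE I (fun j => V j) _ 0 i id (Tagged V x) (erefl i)). Qed.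

Lemma part_ne (R : comPzRingType) (I : eqType) (V : I -> lmodType R) i
  (x : {i : I & V i}) : tag x != i -> part i x = 0.
Proof. exact: untag_dflt. Qed.

Lemma part_eq (R : comPzRingType) (I : eqType) (V : I -> lmodType R) i
  (x : {i : I & V i}) : tag x = i -> Tagged V (part i x) = x.
Proof. by case: x => j x /= e; subst j; rewrite partE. Qed.

Lemma part_part (R : comPzRingType) (I : eqType) (V : I -> lmodType R) i j
  (x : {i : I & V i}) : tag x = i -> part j (Tagged V (part i x)) = part j x.
Proof. by move=> e; rewrite part_eq. Qed.

Lemma part_lin (R : comPzRingType) (I : eqType) (V : I -> lmodType R) i j
  (a : R) (u v : V i) :
  part j (Tagged V (a *: u + v)) = a *: part j (Tagged V u) + part j (Tagged V v).
Proof.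
have [e|ne] := eqVneq i j; last by rewrite !part_ne // scaler0 addr0.
by subst j; rewrite !partE.
Qed.

Lemma part0 (R : comPzRingType) (I : eqType) (V : I -> lmodType R) i j :
  part j (Tagged V (0 : V i)) = 0.
Proof.
have [e|ne] := eqVneq i j; last by rewrite part_ne.
by subst j; rewrite partE.
Qed.

Lemma part_scale (R : comPzRingType) (I : eqType) (V : I -> lmodType R) i j
  (a : R) (u : V i) : part j (Tagged V (a *: u)) = a *: part j (Tagged V u).
Proof. by rewrite -[a *: u]addr0 part_lin part0 addr0. Qed.

Lemma multilinear_closed (R : comPzRingType) (A : gmod R) (n : nat) (k : int) :
  submod_closed (@multilinearb R A n k).
Proof.
split=> [|a f g /asboolP[f0 fL] /asboolP[g0 gL]]; apply/asboolP; split=> //.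
- by move=> s1 s2 d a u v e; rewrite /happ !part0 scaler0 addr0.
- by move=> xs sxs; rewrite dprod_linE f0 // g0 // scaler0 addr0.
move=> s1 s2 d b u v e; rewrite /happ !dprod_linE !part_lin -!/(happ _ _) fL gL.
by rewrite !scalerDr !scalerA [b * a]mulrC !addrA; congr (_ + _); rewrite -!addrA;
  congr (_ + _); rewrite addrC.
Qed.

HB.instance Definition _ (R : comPzRingType) (A : gmod R) (n : nat) (k : int) :=
  GRing.isSubmodClosed.Build R _
    (@multilinearb R A n k)
    (@multilinear_closed R A n k).
HB.instance Definition _ (R : comPzRingType) (A : gmod R) (n : nat) (k : int) :=
  [SubChoice_isSubLmodule of ghom A n k by <:].

Lemma hom_linE (R : comPzRingType) (A : gmod R) n k (a : R) (f g : ghom A n k) xs :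
  (a *: f + g : ghom A n k) xs = a *: f xs + g xs.
Proof. by []. Qed.

Lemma hom_ext (R : comPzRingType) (A : gmod R) n k (f g : ghom A n k) :
  (forall xs, f xs = g xs) -> f = g.
Proof. by move=> fg; apply/val_inj/functional_extensionality_dep. Qed.

Lemma hom_multilinear (R : comPzRingType) (A : gmod R) n k (f : ghom A n k) :
  multilinear n f.
Proof. by case: f => f /= /asboolP. Qed.

Definition mk_ghom (R : comPzRingType) (A : gmod R) n k (f : multifun A k)
  (fP : multilinear n f) : ghom A n k := GHom (asboolT fP : multilinearb n f).

Lemma hom_size (R : comPzRingType) (A : gmod R) n k (f : ghom A n k) xs e :
  size xs != n -> dpart e (happ f xs) = 0.
Proof. by move=> ne; rewrite /happ (proj1 (hom_multilinear f)) // part0. Qed.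

Lemma hom_lin (R : comPzRingType) (A : gmod R) n k (f : ghom A n k) s1 s2 d
  (a : R) (u v : A d) e :
  dpart e (happ f (s1 ++ Tagged A (a *: u + v) :: s2)) =
  a *: dpart e (happ f (s1 ++ Tagged A u :: s2)) +
  dpart e (happ f (s1 ++ Tagged A v :: s2)).
Proof. exact: (proj2 (hom_multilinear f)). Qed.

Lemma hom_zero (R : comPzRingType) (A : gmod R) n k (f : ghom A n k) s1 s2 d e :
  dpart e (happ f (s1 ++ Tagged A (0 : A d) :: s2)) = 0.
Proof.
have := @hom_lin R A n k f s1 s2 d (-1) 0 0 e.
by rewrite scaler0 addr0 scaleN1r addNr.
Qed.

Lemma sdeg_cat (R : comPzRingType) (A : gmod R) (s1 s2 : seq (hel A)) :
  sdeg (s1 ++ s2) = sdeg s1 + sdeg s2.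
Proof. by rewrite /sdeg big_cat. Qed.

Lemma sdeg_cons (R : comPzRingType) (A : gmod R) (x : hel A) s :
  sdeg (x :: s) = tag x + sdeg s.
Proof. by rewrite /sdeg big_cons. Qed.

Lemma sdeg_slices (R : comPzRingType) (A : gmod R) (xs : seq (hel A)) r m :
  sdeg (take r xs) + sdeg (take m (drop r xs)) + sdeg (drop (r + m)%N xs) = sdeg xs.
Proof. by rewrite -addrA addnC -drop_drop -!sdeg_cat !cat_take_drop. Qed.

(* f o_{r+1} g = f (1^{(x) r} (x) g (x) 1^{(x) n-r-1}); the sign is the Koszul
   sign of g passing the first r arguments. *)
Definition end_circ_fun (R : comPzRingType) (A : gmod R) n k m l (r : nat)
  (f : ghom A n k) (g : ghom A m l) : multifun A (k + l) := fun xs =>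
  sgn R (l * sdeg (take r xs)) *:
  dpart (k + l + sdeg xs)
    (happ f (take r xs ++ happ g (take m (drop r xs)) :: drop (r + m)%N xs)).

Lemma scale_lin (R : comPzRingType) (V : lmodType R) (c a : R) (u v : V) :
  c *: (a *: u + v) = a *: (c *: u) + c *: v.
Proof. by rewrite scalerDr !scalerA mulrC. Qed.

Lemma take_mid (T : Type) r (s1 s2 : seq T) x : (size s1 < r)%N ->
  take r (s1 ++ x :: s2) = s1 ++ x :: take (r - size s1).-1 s2.
Proof. by move=> h; rewrite take_cat ltnNge ltnW //=;
  case: (r - _)%N (subn_gt0 (size s1) r) => //; rewrite h. Qed.

Lemma drop_mid (T : Type) r (s1 s2 : seq T) x : (size s1 < r)%N ->
  drop r (s1 ++ x :: s2) = drop (r - size s1).-1 s2.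
Proof. by move=> h; rewrite drop_cat ltnNge ltnW //=;
  case: (r - _)%N (subn_gt0 (size s1) r) => //; rewrite h. Qed.

Lemma take_front (T : Type) r (s1 s2 : seq T) : (r <= size s1)%N ->
  take r (s1 ++ s2) = take r s1.
Proof. by rewrite take_cat; case: ltngtP => // -> _; rewrite subnn take0 cats0 take_size. Qed.

Lemma drop_front (T : Type) r (s1 s2 : seq T) : (r <= size s1)%N ->
  drop r (s1 ++ s2) = drop r s1 ++ s2.
Proof. by rewrite drop_cat; case: ltngtP => // -> _; rewrite subnn drop0 drop_size. Qed.

Lemma hom_lin_at (R : comPzRingType) (A : gmod R) n k (f : ghom A n k) s1 s2
  (a : R) D (w u v : hel A) e :
  tag w = D -> tag u = D -> tag v = D ->
  dpart D w = a *: dpart D u + dpart D v ->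
  dpart e (happ f (s1 ++ w :: s2)) =
  a *: dpart e (happ f (s1 ++ u :: s2)) + dpart e (happ f (s1 ++ v :: s2)).
Proof.
by move=> /part_eq<- /part_eq<- /part_eq<-; rewrite !partE => ->; exact: hom_lin.
Qed.

Lemma end_circ_multilinear (R : comPzRingType) (A : gmod R) n k m l r
  (f : ghom A n k) (g : ghom A m l) :
  multilinear (n + m).-1%N (end_circ_fun r f g).
Proof.
have degE xs : tag (happ f (take r xs ++ happ g (take m (drop r xs)) :: drop (r + m)%N xs))
    = k + l + sdeg xs.
  rewrite /= sdeg_cat sdeg_cons /= -(sdeg_slices xs r m) -!addrA.
  by congr (_ + _); exact: addrCA.
split=> [xs sxs|s1 s2 d a u v e].
  rewrite /end_circ_fun; have [sg|sg] := eqVneq (size (take m (drop r xs))) m.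
    rewrite hom_size ?scaler0 //; move: sxs sg; rewrite size_cat /=.
    by rewrite !size_drop !size_take_min !size_drop => /eqP sxs sg; apply/eqP; lia.
  rewrite /happ (proj1 (hom_multilinear g)) //.
  by rewrite -/(happ _ _) hom_zero scaler0.
rewrite {1 2 3}/happ /end_circ_fun !part_scale !(part_part _ (degE _)).
case: (ltnP (size s1) r) => h1.
  rewrite !take_mid // !(drop_mid _ _ (ltn_addr m h1)) !(drop_mid _ _ h1).
  by rewrite !sdeg_cat !sdeg_cons /= -!catA !cat_cons hom_lin scale_lin.
rewrite !(take_front _ h1) !(drop_front _ h1).
case: (ltnP (size s1) (r + m)%N) => h2.
  have h3 : (size (drop r s1) < m)%N by rewrite size_drop; lia.
  rewrite !(take_mid _ _ h3) !(drop_mid _ _ h2) -scale_lin; congr (_ *: _).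
  have sd (w : A d) t : sdeg (drop r s1 ++ Tagged A w :: t) = sdeg (drop r s1) + (d + sdeg t).
    by rewrite sdeg_cat sdeg_cons.
  by apply: (@hom_lin_at _ _ _ _ _ _ _ _ (l + (sdeg (drop r s1) +
      (d + sdeg (take (m - size (drop r s1)).-1 s2))))); rewrite /= ?sd // hom_lin.
have h3 : (m <= size (drop r s1))%N by rewrite size_drop; lia.
rewrite !(take_front _ h3) !(drop_front _ h2) -scale_lin; congr (_ *: _).
by rewrite -!cat_cons !catA hom_lin.
Qed.

(* Non-symmetric operads of graded modules, through partial compositions:
   ocirc r x y is x o_{r+1} y, which is meaningful for r < n only. *)
Record operad_data (R : comPzRingType) := OperadData {
  oar :> nat -> int -> lmodType R;
  ocirc : forall n k m l, nat -> oar n k -> oar m l -> oar (n + m).-1%N (k + l);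
  ounit : oar 1 0;
  ocirc_linl : forall n k m l r (a : R) (x x' : oar n k) (y : oar m l),
    ocirc r (a *: x + x') y = a *: ocirc r x y + ocirc r x' y;
  ocirc_linr : forall n k m l r (a : R) (x : oar n k) (y y' : oar m l),
    ocirc r x (a *: y + y') = a *: ocirc r x y + ocirc r x y' }.

Notation oarp P := (fun p : nat * int => oar P p.1 p.2).

Definition oel (R : comPzRingType) (P : operad_data R) : Type :=
  {p : nat * int & oarp P p}.

Notation opart P n d x := (@part _ (nat * int)%type (oarp P) (n, d) x).

Definition oelt (R : comPzRingType) (P : operad_data R) n d (x : P n d) : oel P :=
  Tagged (oarp P) (i := (n, d)) x.

Definition oelscale (R : comPzRingType) (P : operad_data R) (a : R) (x : oel P) :
  oel P := Tagged (oarp P) (a *: tagged x).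

Definition circ (R : comPzRingType) (P : operad_data R) (r : nat) (x y : oel P) :
  oel P := oelt (ocirc r (tagged x) (tagged y)).

Definition operad_axioms (R : comPzRingType) (P : operad_data R) : Prop :=
  [/\ forall n k m l p q (x : P n k) (y : P m l) (z : P p q) i j,
        (i < n)%N -> (j < m)%N ->
        circ (i + j)%N (circ i (oelt x) (oelt y)) (oelt z) =
        circ i (oelt x) (circ j (oelt y) (oelt z)),
      forall n k m l p q (x : P n k) (y : P m l) (z : P p q) i j,
        (i < j < n)%N ->
        circ (j + m).-1%N (circ i (oelt x) (oelt y)) (oelt z) =
        oelscale (sgn R (l * q)) (circ i (circ j (oelt x) (oelt z)) (oelt y)),
      forall n k (x : P n k), circ 0 (oelt (ounit P)) (oelt x) = oelt x
    & forall n k (x : P n k) i,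
        (i < n)%N -> circ i (oelt x) (oelt (ounit P)) = oelt x].

Record operad (R : comPzRingType) := Operad {
  operad_car :> operad_data R;
  operadP : operad_axioms operad_car }.

Definition end_circ (R : comPzRingType) (A : gmod R) n k m l r
  (f : ghom A n k) (g : ghom A m l) : ghom A (n + m).-1%N (k + l) :=
  mk_ghom (end_circ_multilinear r f g).

Lemma mk_multilinear (R : comPzRingType) (A : gmod R) n k
  (g : forall D, seq (hel A) -> A D) :
  (forall D xs, size xs != n -> g D xs = 0) ->
  (forall D s1 s2 d (a : R) (u v : A d),
     g D (s1 ++ Tagged A (a *: u + v) :: s2) =
     a *: g D (s1 ++ Tagged A u :: s2) + g D (s1 ++ Tagged A v :: s2)) ->
  multilinear n ((fun xs => g (k + sdeg xs) xs) : multifun A k).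
Proof.
move=> g0 gL; split=> [xs /g0->//|s1 s2 d a u v e].
have appE (w : A d) : happ ((fun xs => g (k + sdeg xs) xs) : multifun A k)
    (s1 ++ Tagged A w :: s2) =
    Tagged A (g (k + (sdeg s1 + (d + sdeg s2))) (s1 ++ Tagged A w :: s2)).
  by rewrite /happ sdeg_cat sdeg_cons.
by rewrite !appE gL part_lin.
Qed.

Lemma end_unit_multilinear (R : comPzRingType) (A : gmod R) :
  multilinear 1 ((fun xs => if xs is [:: x] then dpart (0 + sdeg xs) x else 0) :
    multifun A 0).
Proof.
apply: (@mk_multilinear R A 1 0 (fun D xs => if xs is [:: x] then dpart D x else 0)).
  by move=> D [|x []].
move=> D [|x [|y s1]] [|z s2] d a u v /=; rewrite ?scaler0 ?addr0 //.
exact: part_lin.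
Qed.

Lemma app_hom_linE (R : comPzRingType) (A : gmod R) n k (a : R) (f g : ghom A n k) xs :
  happ (a *: f + g : ghom A n k) xs = Tagged A (a *: f xs + g xs).
Proof. by []. Qed.

Lemma end_circ_linl (R : comPzRingType) (A : gmod R) n k m l r (a : R)
  (f f' : ghom A n k) (g : ghom A m l) :
  end_circ r (a *: f + f') g = a *: end_circ r f g + end_circ r f' g.
Proof.
apply: hom_ext => xs; rewrite hom_linE /= /hom_fun /= /end_circ_fun.
by rewrite app_hom_linE part_lin scale_lin.
Qed.

Lemma end_circ_linr (R : comPzRingType) (A : gmod R) n k m l r (a : R)
  (f : ghom A n k) (g g' : ghom A m l) :
  end_circ r f (a *: g + g') = a *: end_circ r f g + end_circ r f g'.
Proof.
apply: hom_ext => xs; rewrite hom_linE /= /hom_fun /= /end_circ_fun.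
by rewrite app_hom_linE hom_lin scale_lin.
Qed.

Definition end_data (R : comPzRingType) (A : gmod R) : operad_data R :=
  @OperadData R (fun n k => ghom A n k) (@end_circ R A)
    (mk_ghom (@end_unit_multilinear R A)) (@end_circ_linl R A) (@end_circ_linr R A).

Lemma sgn_odd (R : comPzRingType) z : sgn R z = (-1) ^+ (odd `|z|%N).
Proof. by rewrite /sgn signr_odd. Qed.

Lemma sgnD (R : comPzRingType) a b : sgn R (a + b) = sgn R a * sgn R b.
Proof. rewrite !sgn_odd -signr_addb; congr (_ ^+ _); lia. Qed.

Definition hscale (R : comPzRingType) (A : gmod R) (a : R) (x : hel A) :
  hel A := Tagged A (a *: tagged x).

Lemma hscaleA (R : comPzRingType) (A : gmod R) a b (x : hel A) :
  hscale a (hscale b x) = hscale (a * b) x.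
Proof. by rewrite /hscale /= scalerA. Qed.

Lemma hscale1 (R : comPzRingType) (A : gmod R) (x : hel A) : hscale 1 x = x.
Proof. by case: x => d x; rewrite /hscale /= scale1r. Qed.

Lemma tag_circ (R : comPzRingType) (A : gmod R) n k m l r
  (f : ghom A n k) (g : ghom A m l) xs :
  tag (happ f (take r xs ++ happ g (take m (drop r xs)) :: drop (r + m)%N xs)) =
  k + l + sdeg xs.
Proof.
  rewrite /= sdeg_cat sdeg_cons /= -(sdeg_slices xs r m) -!addrA.
  by congr (_ + _); exact: addrCA.
Qed.

Lemma happ_circ (R : comPzRingType) (A : gmod R) n k m l r
  (f : ghom A n k) (g : ghom A m l) xs :
  happ (end_circ r f g) xs =
  hscale (sgn R (l * sdeg (take r xs)))
    (happ f (take r xs ++ happ g (take m (drop r xs)) :: drop (r + m)%N xs)).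
Proof.
rewrite {1}/happ /= /end_circ_fun.
set y := happ f _; have e : tag y = k + l + sdeg xs by apply: tag_circ.
transitivity (hscale (sgn R (l * sdeg (take r xs)))
  (Tagged A (part (k + l + sdeg xs) y))) => //.
by rewrite part_eq.
Qed.

Lemma happ_hscale (R : comPzRingType) (A : gmod R) n k (f : ghom A n k) s1 a y s2 :
  happ f (s1 ++ hscale a y :: s2) = hscale a (happ f (s1 ++ y :: s2)).
Proof.
have e : sdeg (s1 ++ hscale a y :: s2) = sdeg (s1 ++ y :: s2) by rewrite !sdeg_cat !sdeg_cons.
have t : tag (happ f (s1 ++ hscale a y :: s2)) = k + sdeg (s1 ++ y :: s2) by rewrite /= e.
rewrite -(part_eq t) /hscale; congr (Tagged _ _).
case: y t {e} => d y t.
have := @hom_lin R A n k f s1 s2 d a y 0 (k + sdeg (s1 ++ Tagged A y :: s2)).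
rewrite addr0 hom_zero addr0 => ->; congr (_ *: _).
by rewrite partE.
Qed.

Lemma oelt_eq (R : comPzRingType) (A : gmod R) n n' k k' (f : ghom A n k) (f' : ghom A n' k') :
  n = n' -> k = k' -> (forall xs, size xs = n -> happ f xs = happ f' xs) ->
  oelt (P := end_data A) f = oelt (P := end_data A) f'.
Proof.
move=> e1 e2; subst n' k' => h; congr (oelt _); apply: hom_ext => xs.
have [sx|sx] := eqVneq (size xs) n; last first.
  have h1 (g : ghom A n k) : g xs = 0 by exact: (proj1 (hom_multilinear g)).
  by rewrite !h1.
have := h xs sx; rewrite /happ => /(congr1 (fun z => part (k + sdeg xs) z)).
by rewrite !partE.
Qed.

Lemma circ_cat (R : comPzRingType) (A : gmod R) n k m l (f : ghom A n k)
  (g : ghom A m l) r a b c :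
  size a = r -> size b = m ->
  happ (end_circ r f g) (a ++ b ++ c) =
  hscale (sgn R (l * sdeg a)) (happ f (a ++ happ g b :: c)).
Proof.
move=> sa sb; rewrite happ_circ take_size_cat // drop_size_cat // take_size_cat //.
by rewrite catA drop_size_cat // size_cat sa sb.
Qed.

Lemma split_at (R : comPzRingType) (A : gmod R) (s : seq (hel A)) i :
  (i <= size s)%N -> exists a b, size a = i /\ s = a ++ b.
Proof. by move=> h; exists (take i s), (drop i s); rewrite cat_take_drop size_takel. Qed.

Lemma end_axioms (R : comPzRingType) (A : gmod R) : operad_axioms (end_data A).
Proof.
split.
- move=> n k m l p q f g h i j li lj.
  apply: (oelt_eq (f := end_circ (i+j)%N (end_circ i f g) h)
    (f' := end_circ i f (end_circ j g h))); [lia | by rewrite /= addrA |].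
  move=> xs sx.
  have [|a [xs1 [sa e1]]] := @split_at R A xs i; first lia.
  have s1 : size xs1 = (size xs - i)%N by rewrite e1 size_cat; lia.
  have [|b [xs2 [sb e2]]] := @split_at R A xs1 j; first lia.
  have s2 : size xs2 = (size xs1 - j)%N by rewrite e2 size_cat; lia.
  have [|c [xs3 [sc e3]]] := @split_at R A xs2 p; first lia.
  have s3 : size xs3 = (size xs2 - p)%N by rewrite e3 size_cat; lia.
  have [|d [e [sd e4]]] := @split_at R A xs3 (m - j - 1)%N; first lia.
  rewrite {}e1 {}e2 {}e3 {}e4.
  rewrite (_ : a ++ b ++ c ++ d ++ e = (a ++ b) ++ c ++ (d ++ e));
    last by rewrite -!catA.
  rewrite circ_cat ?size_cat ?sa ?sb //.
  rewrite (_ : (a ++ b) ++ happ h c :: d ++ e = a ++ (b ++ happ h c :: d) ++ e);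
    last by rewrite -!catA.
  rewrite circ_cat //; last by rewrite size_cat /=; lia.
  rewrite (_ : (a ++ b) ++ c ++ (d ++ e) = a ++ (b ++ c ++ d) ++ e);
    last by rewrite -!catA.
  rewrite circ_cat //; last by rewrite !size_cat; lia.
  rewrite circ_cat // happ_hscale !hscaleA -!sgnD; congr (hscale (sgn _ _) _).
  rewrite sdeg_cat; ring.
- move=> n k m l p q f g h i j lij.
  have -> : oelscale (sgn R (l * q))
      (circ (P := end_data A) i (circ (P := end_data A) j
        (oelt (P := end_data A) f) (oelt (P := end_data A) h))
        (oelt (P := end_data A) g)) =
      oelt (P := end_data A) (sgn R (l * q) *: end_circ i (end_circ j f h) g) by [].
  apply: (oelt_eq (f := end_circ (j + m).-1 (end_circ i f g) h)); [lia | by rewrite /= addrAC |].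
  move=> xs sx.
  have -> : happ (sgn R (l * q) *: end_circ i (end_circ j f h) g : ghom A _ _) xs =
      hscale (sgn R (l * q)) (happ (end_circ i (end_circ j f h) g) xs) by [].
  have [|a [xs1 [sa e1]]] := @split_at R A xs i; first lia.
  have s1 : size xs1 = (size xs - i)%N by rewrite e1 size_cat; lia.
  have [|b [xs2 [sb e2]]] := @split_at R A xs1 m; first lia.
  have s2 : size xs2 = (size xs1 - m)%N by rewrite e2 size_cat; lia.
  have [|c [xs3 [sc e3]]] := @split_at R A xs2 (j - i - 1)%N; first lia.
  have s3 : size xs3 = (size xs2 - (j - i - 1))%N by rewrite e3 size_cat; lia.
  have [|d [e [sd e4]]] := @split_at R A xs3 p; first lia.
  rewrite {}e1 {}e2 {}e3 {}e4.
  rewrite (_ : a ++ b ++ c ++ d ++ e = (a ++ b ++ c) ++ d ++ e);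
    last by rewrite -!catA.
  rewrite circ_cat //; last by rewrite !size_cat; lia.
  rewrite (_ : (a ++ b ++ c) ++ happ h d :: e = a ++ b ++ (c ++ happ h d :: e));
    last by rewrite -!catA.
  rewrite circ_cat //.
  rewrite -!catA circ_cat //.
  rewrite (_ : a ++ happ g b :: c ++ d ++ e = (a ++ happ g b :: c) ++ d ++ e);
    last by rewrite -!catA.
  rewrite circ_cat //; last by rewrite size_cat /=; lia.
  rewrite !hscaleA -!sgnD -!catA /=.
  have sgn2 u X : sgn R (u + u + X) = sgn R X by rewrite !sgn_odd; congr (_ ^+ _); lia.
  rewrite -[in LHS](sgn2 (l * q)); congr (hscale (sgn _ _) _).
  rewrite !sdeg_cat sdeg_cons /=; ring.
- move=> n k f.
  apply: (oelt_eq (f := end_circ 0 (ounit (end_data A)) f)); [by rewrite ?add1n| by rewrite /= add0r|].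
  move=> xs sx; rewrite -[in LHS](cats0 xs) -[in LHS](cat0s (xs ++ [::])) circ_cat //.
  rewrite {1}/sdeg big_nil mulr0 /sgn expr0 hscale1 /= {1}/happ /= part_eq //=.
  by rewrite sdeg_cons /sdeg big_nil /= add0r addr0.
- move=> n k f i li.
  apply: (oelt_eq (f := end_circ i f (ounit (end_data A)))); [by rewrite addn1| by rewrite /= addr0|].
  move=> xs sx.
  have [|a [xs1 [sa e1]]] := @split_at R A xs i; first lia.
  have s1 : size xs1 = (size xs - i)%N by rewrite e1 size_cat; lia.
  case: xs1 e1 s1 => [|x c] e1 s1; first by move: s1 => /=; lia.
  rewrite e1 -[x :: c]/([:: x] ++ c) circ_cat // mul0r /sgn expr0 hscale1.
  congr (happ f (_ ++ _ :: _)).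
  by rewrite /happ /= part_eq //= sdeg_cons /sdeg big_nil add0r addr0.
Qed.

Definition EndA (R : comPzRingType) (A : gmod R) : operad R :=
  Operad (@end_axioms R A).

(* Ps(n) = P(n) (x) Lambda(n), in which x in P(n) has the natural degree
   n + deg x - 1; with d and e the natural degrees of x and y, deg y is
   e + 1 - m. *)
Definition susp_circ (R : comPzRingType) (P : operad_data R) (n : nat) (d : int)
  (m : nat) (e : int) (r : nat)
  (x : P n (d + 1 - n%:Z)) (y : P m (e + 1 - m%:Z)) :
  P (n + m).-1%N (d + e + 1 - ((n + m).-1%N)%:Z) :=
  sgn R ((n%:Z - 1) * (e + 1 - m%:Z) + (n%:Z - 1) * (m%:Z - 1) + r%:Z * (m%:Z - 1)) *:
  opart P (n + m).-1%N (d + e + 1 - ((n + m).-1%N)%:Z)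
    (oelt (ocirc r x y)).

Lemma susp_circ_linl (R : comPzRingType) (P : operad_data R) n d m e r (a : R)
  (x x' : P n (d + 1 - n%:Z)) (y : P m (e + 1 - m%:Z)) :
  susp_circ r (a *: x + x') y = a *: susp_circ r x y + susp_circ r x' y.
Proof. by rewrite /susp_circ ocirc_linl part_lin scale_lin. Qed.

Lemma susp_circ_linr (R : comPzRingType) (P : operad_data R) n d m e r (a : R)
  (x : P n (d + 1 - n%:Z)) (y y' : P m (e + 1 - m%:Z)) :
  susp_circ r x (a *: y + y') = a *: susp_circ r x y + susp_circ r x y'.
Proof. by rewrite /susp_circ ocirc_linr part_lin scale_lin. Qed.

Definition susp (R : comPzRingType) (P : operad_data R) : operad_data R :=
  @OperadData R (fun n d => P n (d + 1 - n%:Z)) (@susp_circ R P)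
    (opart P 1%N (0 + 1 - 1%:Z) (oelt (ounit P)))
    (@susp_circ_linl R P) (@susp_circ_linr R P).

Definition tot (R : comPzRingType) (P : operad_data R) : gmod R :=
  fun d => dprod (fun n => P n d).

Definition ar (R : comPzRingType) (P : operad_data R) (n : nat) (x : hel (tot P)) :
  oel P := oelt ((tagged x : dprod _) n).

(* gamma(x; a_1, ..., a_N) = (...((x o_1 a_1) o_{k_1 + 1} a_2)...), with k_i the
   arity of a_i: inserting from left to right produces no Koszul sign. *)
Fixpoint gamma_from (R : comPzRingType) (P : operad_data R) (p : nat) (x : oel P)
  (s : seq (oel P)) : oel P :=
  if s is a :: s' then gamma_from (p + (tag a).1)%N (circ p x a) s' else x.

Definition gamma (R : comPzRingType) (P : operad_data R) (x : oel P)
  (s : seq (oel P)) : oel P := gamma_from 0 x s.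

Fixpoint with_units (R : comPzRingType) (P : operad_data R) (w : seq bool)
  (s : seq (oel P)) : seq (oel P) :=
  match w, s with
  | true :: w', x :: s' => x :: with_units w' s'
  | false :: w', _ => oelt (ounit P) :: with_units w' s
  | _, _ => [::]
  end.

(* The part of degree D and arity N of b_n(x; x_1, ..., x_n), where xs is
   [:: x; x_1; ...; x_n].  An element of the product over all arities is the
   family of its components; a0, a_1, ..., a_n are the arities of the components
   of x, x_1, ..., x_n, and the mask w marks the inputs of x which receive
   x_1, ..., x_n, the others receiving the unit.  The bounds on the arities lose
   nothing since a0 + a_1 + ... + a_n = N + n and n <= a0. *)
Definition brace_part (R : comPzRingType) (P : operad_data R) (n : nat) (D : int)
  (xs : seq (hel (tot P))) : tot P D := fun N =>
  if xs is x :: ys then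
    if size ys == n then
      \sum_(a0 < (N + n).+1%N) \sum_(a : n.-tuple 'I_N.+1)
        \sum_(w : a0.-tuple bool | count id w == n)
          opart P N D
            (gamma (ar a0 x) (with_units w [seq ar (val p.2) p.1 | p <- zip ys a]))
    else 0
  else 0.

Definition lincomb (R : comPzRingType) (I : eqType) (V : I -> lmodType R) (a : R)
  (w u v : {i : I & V i}) : Prop :=
  exists i (x y : V i),
    [/\ w = Tagged V (a *: x + y), u = Tagged V x & v = Tagged V y].

Lemma lincomb_part (R : comPzRingType) (I : eqType) (V : I -> lmodType R) (a : R)
  (w u v : {i : I & V i}) j :
  lincomb a w u v -> part j w = a *: part j u + part j v.
Proof. by move=> [i [x [y [-> -> ->]]]]; rewrite part_lin. Qed.

Lemma lincomb_opart (R : comPzRingType) (P : operad_data R) (a : R) (w u v : oel P) N D :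
  lincomb a w u v ->
  opart P N D w =
  a *: (opart P N D u : P N D) + opart P N D v :> P N D.
Proof. by move=> [i [x [y [-> -> ->]]]]; have := part_lin (V := oarp P) (N, D) a x y. Qed.

Lemma lincomb_circl (R : comPzRingType) (P : operad_data R) r a (w u v z : oel P) :
  lincomb a w u v -> lincomb a (circ r w z) (circ r u z) (circ r v z).
Proof.
move=> [i [x [y [-> -> ->]]]]; exists ((i.1 + (tag z).1).-1%N, i.2 + (tag z).2).
exists (ocirc r x (tagged z)), (ocirc r y (tagged z)); split=> //.
by rewrite -ocirc_linl.
Qed.

Lemma lincomb_circr (R : comPzRingType) (P : operad_data R) r a (w u v z : oel P) :
  lincomb a w u v -> lincomb a (circ r z w) (circ r z u) (circ r z v).
Proof.
move=> [i [x [y [-> -> ->]]]]; exists (((tag z).1 + i.1).-1%N, (tag z).2 + i.2).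
exists (ocirc r (tagged z) x), (ocirc r (tagged z) y); split=> //.
by rewrite -ocirc_linr.
Qed.

Lemma lincomb_gammal (R : comPzRingType) (P : operad_data R) p a (w u v : oel P) s :
  lincomb a w u v ->
  lincomb a (gamma_from p w s) (gamma_from p u s) (gamma_from p v s).
Proof.
by elim: s p w u v => [|z s IHs] p w u v //= h; apply/IHs/lincomb_circl.
Qed.

Lemma lincomb_gammar (R : comPzRingType) (P : operad_data R) p a (x w u v : oel P) s1 s2 :
  lincomb a w u v ->
  lincomb a (gamma_from p x (s1 ++ w :: s2)) (gamma_from p x (s1 ++ u :: s2))
    (gamma_from p x (s1 ++ v :: s2)).
Proof.
move=> h; elim: s1 p x => [|z s1 IHs] p x /=; last exact: IHs.
have [i [y [y' [ew eu ev]]]] := h.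
rewrite ew eu ev /= -ew -eu -ev; exact/lincomb_gammal/lincomb_circr.
Qed.

Lemma lincomb_ar (R : comPzRingType) (P : operad_data R) n d a (u v : tot P d) :
  lincomb a (ar n (Tagged (tot P) (a *: u + v))) (ar n (Tagged (tot P) u))
    (ar n (Tagged (tot P) v)).
Proof. by exists (n, d), ((u : dprod _) n), ((v : dprod _) n). Qed.

Lemma with_units_slot (R : comPzRingType) (P : operad_data R) w (s1 s2 : seq (oel P)) :
  (size s1 < count id w)%N ->
  exists t1 t2, forall z, with_units w (s1 ++ z :: s2) = t1 ++ z :: t2.
Proof.
elim: w s1 => [|[] w IHw] [|x s1] //= h.
- by exists [::], (with_units w s2).
- have [|t1 [t2 e]] := IHw s1; first by rewrite add1n ltnS in h.
  by exists (x :: t1), t2 => z; rewrite e.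
- have [t1 [t2 e]] := IHw [::] h.
  by exists (oelt (ounit P) :: t1), t2 => z; rewrite /= -e.
- have [t1 [t2 e]] := IHw (x :: s1) h.
  by exists (oelt (ounit P) :: t1), t2 => z; rewrite /= -e.
Qed.

Lemma zip_slot (T U : Type) (s1 s2 : seq T) (a : seq U) :
  size a = (size s1 + size s2).+1 ->
  exists a1 c a2, size a1 = size s1 /\ forall z,
    zip (s1 ++ z :: s2) a = zip s1 a1 ++ (z, c) :: zip s2 a2.
Proof.
elim: s1 a => [|x s1 IHs] [|c a] //= [sa]; first by exists [::], c, a.
have [a1 [c' [a2 [sa1 e]]]] := IHs a sa.
by exists (c :: a1), c', a2; split=> [|z]; rewrite /= ?sa1 ?e.
Qed.

Lemma brace_part_lin (R : comPzRingType) (P : operad_data R) n D s1 s2 d (a : R)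
  (u v : tot P d) :
  brace_part n D (s1 ++ Tagged (tot P) (a *: u + v) :: s2) =
  a *: brace_part n D (s1 ++ Tagged (tot P) u :: s2) +
  brace_part n D (s1 ++ Tagged (tot P) v :: s2).
Proof.
apply: functional_extensionality_dep => N; rewrite dprod_linE /brace_part.
case: s1 => [|x s1] /=.
  case: eqP => _; last by rewrite scaler0 addr0.
  do 3![rewrite scaler_sumr -big_split /=; apply: eq_bigr => ? ?].
  apply: lincomb_opart; exact/lincomb_gammal/lincomb_ar.
rewrite !size_cat /=; case: eqP => [en|_]; last by rewrite scaler0 addr0.
rewrite scaler_sumr -big_split /=; apply: eq_bigr => a0 _.
rewrite scaler_sumr -big_split /=; apply: eq_bigr => b _.
rewrite scaler_sumr -big_split /=; apply: eq_bigr => w /eqP cw.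
have sb : size b = (size s1 + size s2).+1 by rewrite size_tuple -en addnS.
have [a1 [c [a2 [sa1 e]]]] := zip_slot sb.
rewrite !e !map_cat /=.
have [|t1 [t2 e']] := @with_units_slot R P w
  [seq ar (val p.2) p.1 | p <- zip s1 a1] [seq ar (val p.2) p.1 | p <- zip s2 a2].
  by rewrite cw size_map size1_zip ?sa1 // -en addnS ltnS leq_addr.
rewrite !e'; apply: lincomb_opart; exact/lincomb_gammar/lincomb_ar.
Qed.

Lemma brace_multilinear (R : comPzRingType) (P : operad_data R) n :
  multilinear n.+1
    ((fun xs => brace_part n (0 + sdeg xs) xs) : multifun (tot P) 0).
Proof.
apply: (@mk_multilinear R (tot P) n.+1 0 (fun D xs => brace_part n D xs)).
  move=> D [|x ys] /= sxs; apply: functional_extensionality_dep => N //.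
  by rewrite /brace_part ifN.
exact: brace_part_lin.
Qed.

Definition brace (R : comPzRingType) (P : operad_data R) (n : nat) :
  ghom (tot P) n.+1 0 := mk_ghom (@brace_multilinear R P n).

(* The part of arity N of m ~o m = sum_r m ~o_{r+1} m. *)
Definition square (R : comPzRingType) (P : operad_data R) (m : tot P 1) (N : nat) :
  P N (1 + 1) :=
  \sum_(a < N.+2) \sum_(b < N.+1) \sum_(r < a)
    opart P N (1 + 1)
      (circ r (ar a (Tagged (tot P) m)) (ar b (Tagged (tot P) m))).

Definition ainf_multiplication (R : comPzRingType) (O : operad_data R)
  (m : tot (susp O) 1) : Prop :=
  m 0%N = 0 /\ forall N, square m N = 0.

(* m_{r+1+t} (1^{(x) r} (x) m_q (x) 1^{(x) t}) is m_{r+1+t} o_{r+1} m_q in EndA A;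
   the structure maps are indexed by j >= 1, hence the condition m 0 = 0. *)
Definition ainf_algebra (R : comPzRingType) (A : gmod R)
  (m : forall j, ghom A j (2 - j%:Z)) : Prop :=
  m 0%N = 0 /\
  forall v, (0 < v)%N ->
    \sum_(r < v.+1) \sum_(q < v.+1 | (0 < q)%N && (r + q <= v)%N)
      (let t := (v - r - q)%N in
      sgn R (r * q + t)%N *:
      opart (EndA A) v (3 - v%:Z)
        (circ (P := EndA A) r (oelt (P := EndA A) (m (r + 1 + t)%N))
           (oelt (P := EndA A) (m q)))) = 0 :> ghom A v (3 - v%:Z).

Definition degs (R : comPzRingType) (A : gmod R) (xs : seq (hel A)) : seq int :=
  [seq tag x | x <- xs].

Definition induced_part (R : comPzRingType) (B : gmod R)
  (b : forall n, ghom B n.+1 0) (m : hel B) (j : nat) (D : int)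
  (xs : seq (hel B)) : B D :=
  match j with
  | 0%N => 0
  | 1%N => dpart D (happ (b 1%N) (m :: xs))
           - sgn R (sdeg xs) *: dpart D (happ (b 1%N) (rcons xs m))
  | _ => dpart D (happ (b j) (m :: xs))
  end.

Lemma induced_multilinear (R : comPzRingType) (B : gmod R)
  (b : forall n, ghom B n.+1 0) (m : hel B) j :
  multilinear j ((fun xs => induced_part b m j (1 + sdeg xs) xs) : multifun B 1).
Proof.
apply: (@mk_multilinear R B j 1 (induced_part b m j)).
  move=> D xs; case: j => [|[|j]] //= sxs; last by rewrite hom_size.
  by rewrite !hom_size ?scaler0 ?subr0 //= size_rcons.
move=> D s1 s2 d a u v; case: j => [|[|j]] /=; rewrite ?scaler0 ?addr0 //.
  rewrite -cat_cons hom_lin !rcons_cat !rcons_cons hom_lin !sdeg_cat !sdeg_cons /=.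
  by rewrite scale_lin scalerBr opprD addrACA.
by rewrite -cat_cons hom_lin.
Qed.

(* M'_j : B^{(x) j} -> B, of degree 1. *)
Definition induced (R : comPzRingType) (B : gmod R) (b : forall n, ghom B n.+1 0)
  (m : hel B) (j : nat) : ghom B j 1 := mk_ghom (@induced_multilinear R B b m j).

(* S o f o (S^{(x) j})^-1 : the Koszul rule gives S^{(x) j} (x_1, ..., x_j) =
   (-1)^(sum_i (j - i) |x_i|) (S x_1, ..., S x_j). *)
Definition shift_part (R : comPzRingType) (B : gmod R) (j : nat) (f : ghom B j 1)
  (D : int) (xs : seq (hel (gshift B))) : gshift B D :=
  let zs := [seq shSinv x | x <- xs] in
  sgn R (\sum_(i < j) (j%:Z - i.+1%:Z) * (degs zs)`_i) *: dpart D (shS (happ f zs)).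

Lemma part_shS (R : comPzRingType) (B : gmod R) D (x : hel B) :
  dpart D (shS x) = dpart (D - 1) x.
Proof.
have [<-|ne] := eqVneq (tag x + 1) D; last first.
  rewrite !part_ne //; apply: contraNneq ne => ->; exact/eqP/subrK.
rewrite /shS partE.
change (ecast d (B d) (esym (addrK 1 (tag x))) (tagged x) =
  part (tag x + 1 - 1) x :> B (tag x + 1 - 1)); case: x => d x /=.
by move: (addrK 1 d); move: (d + 1 - 1) => d' e; subst d'; rewrite partE.
Qed.

Lemma shift_multilinear (R : comPzRingType) (B : gmod R) j (f : ghom B j 1) :
  multilinear j ((fun xs => shift_part f (2 - j%:Z + sdeg xs) xs) :
    multifun (gshift B) (2 - j%:Z)).
Proof.
apply: (@mk_multilinear R (gshift B) j (2 - j%:Z) (shift_part f)) => D.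
  by move=> xs sxs; rewrite /shift_part part_shS hom_size ?scaler0 ?size_map.
move=> s1 s2 d a u v; rewrite /shift_part !part_shS !map_cat /= /degs !map_cat /=.
have := @hom_lin R B j 1 f [seq shSinv x | x <- s1] [seq shSinv x | x <- s2]
  (d - 1) a u v (D - 1).
by rewrite -scale_lin => <-.
Qed.

Definition shifted (R : comPzRingType) (B : gmod R) (j : nat) (f : ghom B j 1) :
  ghom (gshift B) j (2 - j%:Z) := mk_ghom (shift_multilinear f).

(* The A_oo-structure M_j on S(sO) induced by m in sO of natural degree 1. *)
Definition inducedM (R : comPzRingType) (O : operad_data R) (m : tot (susp O) 1)
  (j : nat) : ghom (gshift (tot (susp O))) j (2 - j%:Z) :=
  shifted (induced (brace (susp O)) (Tagged (tot (susp O)) m) j).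

(* m_1 + m_2 + ... in s(End_A), of natural degree 1. *)
Definition ainf_sum (R : comPzRingType) (A : gmod R)
  (m : forall j, ghom A j (2 - j%:Z)) : tot (susp (EndA A)) 1 := m.

Definition bapp (R : comPzRingType) (B : gmod R) (b : forall n, ghom B n.+1 0)
  (x : hel B) (ys : seq (hel B)) : hel B := happ (b (size ys)) (x :: ys).

Definition mapp (R : comPzRingType) (V : gmod R)
  (M : forall j, ghom V j (2 - j%:Z)) (xs : seq (hel V)) : hel V :=
  happ (M (size xs)) xs.

(* y_i, ..., y_{i+k-1}; positions are counted from 1. *)
Definition slice (T : Type) (i k : nat) (ys : seq T) : seq T := take k (drop i.-1 ys).

(* For c = [:: (i_1, k_1); ...; (i_n, k_n)], the list
   y_o, ..., b_{k_1}(x_1; y_{i_1}, ..., y_{i_1+k_1-1}), ...,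
   b_{k_n}(x_n; y_{i_n}, ...), ..., y_m. *)
Fixpoint weave (R : comPzRingType) (B : gmod R) (b : forall n, ghom B n.+1 0)
  (o : nat) (xs : seq (hel B)) (c : seq (nat * nat)) (ys : seq (hel B)) :
  seq (hel B) :=
  match xs, c with
  | x :: xs', (i, k) :: c' =>
      slice o (i - o) ys ++ bapp b x (slice i k ys) :: weave b (i + k)%N xs' c' ys
  | _, _ => drop o.-1 ys
  end.

(* o <= i_1, i_t + k_t <= i_{t+1} and i_n + k_n <= m + 1. *)
Fixpoint insertion (o m : nat) (c : seq (nat * nat)) : bool :=
  if c is (i, k) :: c' then (o <= i)%N && insertion (i + k)%N m c' else (o <= m.+1)%N.

Definition places (m n : nat) (c : n.-tuple ('I_m.+2 * 'I_m.+1)) : seq (nat * nat) :=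
  [seq (val p.1, val p.2) | p <- c].

Definition brace_algebra (R : comPzRingType) (B : gmod R)
  (b : forall n, ghom B n.+1 0) : Prop :=
  forall (x : hel B) (xs ys : seq (hel B)),
  let n := size xs in let m := size ys in
  let D := tag x + sdeg xs + sdeg ys in
  dpart D (bapp b (bapp b x xs) ys) =
  \sum_(c : n.-tuple ('I_m.+2 * 'I_m.+1) | insertion 1 m (places c))
    sgn R (\sum_(p < n) (degs xs)`_p * sdeg (take (nth 0%N (unzip1 (places c)) p).-1 ys)) *:
    dpart D (bapp b x (weave b 1 xs (places c) ys)).

(* In jrel1 and jrel2, X v, Y v, I v, K v are |x_v|, |y_v|, i_v, k_v, with indices
   counted from 1 and the value 0 at the index 0. *)

Definition jeps1 (n k i : nat) (x : int) (Y : nat -> int) : int :=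
  let l := (n.+1 - k)%N in
  \sum_(1 <= v < i) Y v * (x - k%:Z + 1)
  + \sum_(1 <= v < k.+1) Y (i + v).-1%N * (k%:Z - v%:Z)
  + (l%:Z - i%:Z) * x.

(* The last sum runs over the y_{v+l} which follow the entry M_l(...), at the
   position v + 1 of b_k: their coefficient is k - (v + 1).  With k - v instead
   jrel1 fails: take A = Z concentrated in degree 0, with m_2 the product
   and m_j = 0 otherwise, x = m_2, y_1 = id and y_2 = m_2. *)
Definition jeta (n l i : nat) (Y : nat -> int) : int :=
  let k := (n.+1 - l)%N in
  \sum_(1 <= v < i) (k%:Z - v%:Z) * Y v
  + \sum_(1 <= v < i) l%:Z * Y v
  + \sum_(i <= v < i + l) (k%:Z - i%:Z) * Y v
  + \sum_(i <= v < (n - l).+1) (k%:Z - v%:Z - 1) * Y (v + l)%N.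

(* The term k_v (|x_w| - k_w + 1) is the Koszul term between the arity k_v of
   b_{k_v}(x_v; ...) and the degree |x_w| - k_w + 1 of x_w as a map of k_w
   arguments on SB.  With k_v |x_w| instead jrel2 fails: take A as above and
   x_1 = x_2 = y_1 = id. *)
Definition jeps2 (j : nat) (X Y : nat -> int) (I K : nat -> nat) : int :=
  \sum_(1 <= t < j.+1) \sum_(1 <= v < (K t).+1) Y (I t + v).-1%N * ((K t)%:Z - v%:Z)
  + \sum_(1 <= v < j.+1) \sum_(v.+1 <= w < j.+1) (K v)%:Z * (X w - (K w)%:Z + 1)
  + \sum_(1 <= v < j.+1) \sum_(v <= w < j.+1)
      X v * ((I w.+1)%:Z - (I w)%:Z - (K w)%:Z)
  + \sum_(0 <= t < j) \sum_(t.+1 <= w < j.+1) \sum_(I t <= v < I t.+1)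
      (Y v + 1) * (X w - (K w)%:Z + 1)
  + \sum_(0 <= v < j) \sum_(v.+1 <= w < j.+1)
      ((I v.+1)%:Z - (I v)%:Z - (K v)%:Z) * (X w - (K w)%:Z + 1).

Definition jlhs_sign (n : nat) (Y : nat -> int) : int :=
  \sum_(1 <= i < n.+1) (n%:Z - i%:Z) * Y i.

Definition jrel1 (R : comPzRingType) (B : gmod R) (b : forall n, ghom B n.+1 0)
  (M : forall j, ghom (gshift B) j (2 - j%:Z)) : Prop :=
  forall (x : hel B) (ys : seq (hel B)),
  let n := size ys in
  let Y := nth 0 (0 :: degs ys) in
  let D := tag x + sdeg ys + 2 in
  sgn R (jlhs_sign n Y) *: dpart D (shS (bapp b (shSinv (mapp M [:: shS x])) ys)) =
  \sum_(0 <= k < n.+1) \sum_(1 <= i < (n - k).+2)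
    sgn R (jeps1 n k i (tag x) Y) *:
    dpart D (mapp M [seq shS z | z <- weave b 1 [:: x] [:: (i, k)] ys])
  - sgn R (tag x) *:
    \sum_(1 <= l < n.+1) \sum_(1 <= i < (n - l).+2)
      sgn R (jeta n l i Y) *:
      dpart D (shS (bapp b x (take i.-1 ys ++
        shSinv (mapp M [seq shS z | z <- slice i l ys]) :: drop (i.-1 + l)%N ys))).

Definition jrel2 (R : comPzRingType) (B : gmod R) (b : forall n, ghom B n.+1 0)
  (M : forall j, ghom (gshift B) j (2 - j%:Z)) : Prop :=
  forall (xs ys : seq (hel B)), (1 < size xs)%N ->
  let j := size xs in let n := size ys in
  let X := nth 0 (0 :: degs xs) in
  let Y := nth 0 (0 :: degs ys) in
  let D := sdeg xs + sdeg ys + 2 in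
  sgn R (jlhs_sign n Y) *:
    dpart D (shS (bapp b (shSinv (mapp M [seq shS z | z <- xs])) ys)) =
  \sum_(c : j.-tuple ('I_n.+2 * 'I_n.+1) | insertion 1 n (places c))
    let I := nth 0%N (0%N :: rcons (unzip1 (places c)) n.+1) in
    let K := nth 0%N (0%N :: unzip2 (places c)) in
    sgn R (jeps2 j X Y I K) *:
    dpart D (mapp M [seq shS z | z <- weave b 1 xs (places c) ys]).

(* A J-algebra structure on V = SB: an A_oo-structure M on SB and a brace
   structure b on B = S^-1 V satisfying the two compatibility relations. *)
Definition J_algebra (R : comPzRingType) (B : gmod R) (b : forall n, ghom B n.+1 0)
  (M : forall j, ghom (gshift B) j (2 - j%:Z)) : Prop :=
  [/\ ainf_algebra M, brace_algebra b, jrel1 b M & jrel2 b M].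

(* The Hochschild complex S(s(End_A)) of (A, m) is a J-algebra, for the induced
   A_oo-structure and the braces of s(End_A). *)
Definition hochschild_J_algebra (R : comPzRingType) (A : gmod R)
  (m : forall j, ghom A j (2 - j%:Z)) : Prop :=
  J_algebra (brace (susp (EndA A))) (inducedM (ainf_sum m)).

(* Main.v *)
Require Import Defs.
From Stdlib Require Import Btauto.
From mathcomp Require Import all_boot all_order all_algebra.
From mathcomp Require Import boolp zify ring.

Set Implicit Arguments.
Unset Strict Implicit.
Unset Printing Implicit Defensive.

Import Order.TTheory GRing.Theory Num.Theory.
Local Open Scope ring_scope.

(** The braces of an operad satisfy the brace relation, and everything else
    follows from that relation together with b_0 = id.

    First, the operadic suspension of an operad is again an operad, in which the
    Koszul sign is the one of the natural degree ([susp_axioms]). Hence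
    it suffices to prove the brace relation for the braces of an arbitrary
    operad; the signs of the suspension occur again only when the relations of an
    A_oo-algebra are read as the vanishing of m ~o m.

    For the brace relation ([brace_brace_algebra]), both sides are sums over the
    ways of reading the inputs of x from left to right. Each input is left
    alone, or receives the next y, or receives the next x_p; in the last case
    the inputs of x_p are read in turn before those of x. On the side of
    b(b(x; xs); ys) one inserts all the xs first and reads the inputs of the
    composite afterwards; on the other side one inserts the braces b(x_p; ...)
    and the remaining ys into x. Both sums satisfy the same recursion on the
    number of inputs of x that are still to be read, by sequential and parallel
    associativity; this is [scan_brace]. The Koszul signs arise when a y jumps
    over the xs which are inserted to its right ([scan_commute],
    [scan_exchange]). The elements of sP are families indexed by all arities,
    but one component of a brace involves finitely many components of its
    arguments, which are gathered in finite lists.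

    For the structure on the shift, let m have degree 1 with b_1(m; m) = 0, and
    let M'_j be the induced maps. Since M'_j = b_j(m; -) for j > 1, relation (2)
    is the brace relation for b_n(b_j(m; xs); ys) term by term, up to signs
    whose agreement is a parity computation ([par_jeps2], [par_weave_degs]).
    In arity one there is also the term b_1(x; m). Expand b_n(b_1(x; m); ys) and
    b_1(b_n(x; ys); m) by the brace relation: the terms in which m stands alone
    among the ys are the same, and what remains is the sum of the terms
    b(x; y, ..., M'_l(y, ...), ..., y). This identity, [derivation], gives
    relation (1); for x = m its left side is zero, and it gives the A_oo
    relations. The hypothesis on m is the relation b_1(m; m) = 0, both for an
    A_oo-multiplication ([bapp_square]) and for an A_oo-algebra
    ([ainf_sum_multiplication]). Finally the assertion about an operad O is the
    one about the A_oo-algebra S(sO). *)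

(** * Parity of signs *)

Definition par (z : int) : bool := odd `|z|%N.

Lemma parD a b : par (a + b) = par a (+) par b.
Proof. rewrite /par; lia. Qed.
Lemma parN a : par (- a) = par a.
Proof. by rewrite /par abszN. Qed.
Lemma parM a b : par (a * b) = par a && par b.
Proof. by rewrite /par abszM oddM. Qed.
Lemma par_nat n : par (Posz n) = odd n.
Proof. by []. Qed.
Lemma par0 : par 0 = false. Proof. by []. Qed.
Lemma par1 : par 1 = true. Proof. by []. Qed.

Lemma sgn_par (R : comPzRingType) a b : par a = par b -> sgn R a = sgn R b.
Proof. by rewrite !sgn_odd /par => ->. Qed.

Lemma sgn0 (R : comPzRingType) : sgn R 0 = 1.
Proof. by rewrite /sgn expr0. Qed.

Lemma sgnZ (R : comPzRingType) (V : lmodType R) a b (v : V) :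
  sgn R a *: (sgn R b *: v) = sgn R (a + b) *: v.
Proof. by rewrite scalerA -sgnD. Qed.

Definition parE := (par0, par1, parD, parN, parM, par_nat).

(** Exclusive or in the form which the decision procedure for boolean rings
    recognises: an identity of signs is an identity in the field with two
    elements. *)
Lemma addb_xorb (a b : bool) : a (+) b = xorb a b.
Proof. by case: a; case: b. Qed.

Ltac parity := rewrite ?parE ?addb_xorb; btauto.

(** * Elements of an operad and the operadic suspension *)

Section Oel.
Variables (R : comPzRingType) (P : operad_data R).
Implicit Types x y z : oel P.

Definition arity x : nat := (tag x).1.
Definition degree x : int := (tag x).2.

Lemma oel_eta x : oelt (tagged x) = x.
Proof. by case: x => -[]. Qed.

Lemma arity_circ r x y : arity (circ r x y) = (arity x + arity y).-1%N.
Proof. by []. Qed.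
Lemma arity_scale a x : arity (oelscale a x) = arity x.
Proof. by []. Qed.

Lemma oelscale1 x : oelscale 1 x = x.
Proof. by case: x => -[n d] x; rewrite /oelscale scale1r. Qed.

Lemma oelscaleA a b x : oelscale a (oelscale b x) = oelscale (a * b) x.
Proof. by rewrite /oelscale /= scalerA. Qed.

Lemma ocirc0l n k m l r (y : P m l) : ocirc r (0 : P n k) y = 0.
Proof.
have := ocirc_linl r (-1) (0 : P n k) 0 y.
by rewrite scaler0 addr0 scaleN1r addNr.
Qed.

Lemma ocirc0r n k m l r (x : P n k) : ocirc r x (0 : P m l) = 0.
Proof.
have := ocirc_linr r (-1) x (0 : P m l) 0.
by rewrite scaler0 addr0 scaleN1r addNr.
Qed.

Lemma circ_scalel r a x y : circ r (oelscale a x) y = oelscale a (circ r x y).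
Proof.
rewrite /circ /oelscale /=; congr (oelt _).
by rewrite -[a *: _]addr0 ocirc_linl ocirc0l addr0.
Qed.

Lemma circ_scaler r a x y : circ r x (oelscale a y) = oelscale a (circ r x y).
Proof.
rewrite /circ /oelscale /=; congr (oelt _).
by rewrite -[a *: _]addr0 ocirc_linr ocirc0r addr0.
Qed.

Hypothesis axP : operad_axioms P.

Lemma circ_seq i j x y z : (i < arity x)%N -> (j < arity y)%N ->
  circ (i + j)%N (circ i x y) z = circ i x (circ j y z).
Proof.
by case: axP => h _ _ _ hi hj; have := h _ _ _ _ _ _ (tagged x) (tagged y) (tagged z) i j hi hj;
  rewrite !oel_eta.
Qed.

Lemma circ_par i j x y z : (i < j < arity x)%N ->
  circ (j + arity y).-1 (circ i x y) z =
  oelscale (sgn R (degree y * degree z)) (circ i (circ j x z) y).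
Proof.
by case: axP => _ h _ _ hij; have := h _ _ _ _ _ _ (tagged x) (tagged y) (tagged z) i j hij;
  rewrite !oel_eta.
Qed.

Lemma circ_unit i x : (i < arity x)%N -> circ i x (oelt (ounit P)) = x.
Proof.
by case: axP => _ _ _ h hi; have := h _ _ (tagged x) i hi; rewrite oel_eta.
Qed.

End Oel.

Section Susp.
Variables (R : comPzRingType) (P : operad_data R).
Hypothesis axP : operad_axioms P.

(** The identification of sP(n) with P(n), which lowers the degree by n - 1. *)
Definition unsusp (x : oel (susp P)) : oel P :=
  @oelt R P (tag x).1 ((tag x).2 + 1 - (tag x).1%:Z) (tagged x).

Lemma unsusp_inj (x y : oel (susp P)) : tag x = tag y -> unsusp x = unsusp y -> x = y.
Proof.
case: x y => [[n d] x] [[n' d'] y] /= [e1 e2]; subst n' d'; rewrite /unsusp /= => h.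
congr (oelt _).
have := congr1 (fun z => opart P n (d + 1 - n%:Z) z) h.
have E u := partE (V := oarp P) (i := (n, d + 1 - n%:Z)) u.
by rewrite !E.
Qed.

Lemma unsusp_circ r (x y : oel (susp P)) : (r < arity x)%N ->
  unsusp (circ r x y) =
  oelscale (sgn R (((arity x)%:Z - 1) * degree y + r%:Z * ((arity y)%:Z - 1)))
    (circ r (unsusp x) (unsusp y)).
Proof.
case: x y => [[n d] x] [[m e] y]; rewrite /arity /degree /= => lr.
rewrite /unsusp /circ /= /susp_circ /oelscale /=.
set s := sgn R _; set s' := sgn R _.
have -> : s = s' by apply: sgn_par; parity.
set z := @oelt R P _ _ (@ocirc R P n (d + 1 - n%:Z) m (e + 1 - m%:Z) r x y).
have tz : tag z = ((n + m).-1%N, d + e + 1 - ((n + m).-1)%:Z).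
  by rewrite /z /=; congr (_, _); lia.
transitivity (oelscale s' (Tagged (oarp P)
  (part ((n + m).-1%N, d + e + 1 - ((n + m).-1)%:Z) z))); first by [].
by rewrite (part_eq tz).
Qed.

(** With d = deg x + n - 1 the sign (n - 1) deg y + (n - 1)(m - 1) + r (m - 1)
    becomes (n - 1) e + r (m - 1), where e is the natural degree of y
    ([unsusp_circ]). The sign deg y * deg z of parallel composition in P and the
    signs of the suspension then add up to the product of the natural degrees
    of y and z. *)
Lemma susp_axioms : operad_axioms (susp P).
Proof.
split.
- move=> n k m l p q x y z i j hi hj.
  apply: unsusp_inj; first by rewrite /=; congr (_, _); [lia | rewrite addrA].
  rewrite !unsusp_circ ?circ_scalel ?circ_scaler ?(circ_seq axP) ?oelscaleA -?sgnD //;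
    try by rewrite /arity /=; lia.
  congr (oelscale _ _); apply: sgn_par; rewrite /arity /degree /=.
  have -> : ((n + m).-1)%:Z = n%:Z + m%:Z - 1 by lia.
  have -> : ((m + p).-1)%N%:Z = m%:Z + p%:Z - 1 by lia.
  by rewrite PoszD; parity.
- move=> n k m l p q x y z i j hij.
  have E a u : unsusp (oelscale a u) = oelscale a (unsusp u) by [].
  apply: unsusp_inj; first by rewrite /=; congr (_, _); [lia | rewrite addrAC].
  rewrite E !unsusp_circ ?circ_scalel ?circ_scaler; try by rewrite /arity /=; lia.
  have := @circ_par _ _ axP i j (unsusp (oelt x)) (unsusp (oelt y)) (unsusp (oelt z)) hij.
  rewrite {1}/arity /= => ->; rewrite !oelscaleA -!sgnD.
  congr (oelscale _ _); apply: sgn_par; rewrite /arity /degree /=.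
  have -> : ((n + m).-1)%:Z = n%:Z + m%:Z - 1 by lia.
  have -> : ((n + p).-1)%N%:Z = n%:Z + p%:Z - 1 by lia.
  have -> : ((j + m).-1)%N%:Z = j%:Z + m%:Z - 1 by lia.
  parity.
- move=> n k x; apply: unsusp_inj; first by rewrite /= add0r.
  have U : unsusp (oelt (ounit (susp P))) = oelt (ounit P).
    rewrite /unsusp /=.
    exact: (part_eq (V := oarp P) (x := oelt (ounit P))).
  rewrite unsusp_circ // U.
  case: axP => _ _ h _; have := h _ _ (tagged (unsusp (oelt x))); rewrite oel_eta => ->.
  by rewrite /arity /= mul0r mul0r addr0 sgn0 oelscale1.
- move=> n k x i hi; apply: unsusp_inj; first by rewrite /= addr0 addn1.
  have U : unsusp (oelt (ounit (susp P))) = oelt (ounit P).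
    rewrite /unsusp /=.
    exact: (part_eq (V := oarp P) (x := oelt (ounit P))).
  rewrite unsusp_circ // U (circ_unit axP) //.
  by rewrite /arity /degree /= subrr !mulr0 addr0 sgn0 oelscale1.
Qed.
End Susp.

(** * Signed sums over order-preserving insertions *)

Lemma eq_big_all (T : Type) (V : zmodType) (p : pred T) (s : seq T) (F G : T -> V) :
  all p s -> (forall x, p x -> F x = G x) ->
  \sum_(x <- s) F x = \sum_(x <- s) G x.
Proof.
move=> + FG; elim: s => [|x s IHs] /=; first by rewrite !big_nil.
by case/andP=> /FG px /IHs; rewrite !big_cons px => ->.
Qed.

Lemma eq_map_all (T U : Type) (p : pred T) (s : seq T) (f g : T -> U) :
  all p s -> (forall x, p x -> f x = g x) -> map f s = map g s.
Proof.
by move=> + fg; elim: s => [|x s IHs] //= /andP[/fg -> /IHs ->].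
Qed.

(** The right side of the brace relation, with a recursion on xs in place of the
    index set of all insertions. The accumulator e is the total degree of the ys
    that have been placed so far, which x has to pass; Phi is the brace into
    which the finished list is inserted. The type T is a parameter since the
    sums occur both for elements of the brace algebra and for lists of
    homogeneous elements of an operad. *)
Section Weave.
Variables (R : comPzRingType) (V : lmodType R) (T : Type).
Variables (B : T -> seq T -> T) (dg : T -> int).

Definition dsum (s : seq T) : int := \sum_(y <- s) dg y.

Lemma dsum_cons y s : dsum (y :: s) = dg y + dsum s.
Proof. by rewrite /dsum big_cons. Qed.
Lemma dsum_nil : dsum [::] = 0.
Proof. by rewrite /dsum big_nil. Qed.

Fixpoint weave_sum (e : int) (Phi : seq T -> V) (xs ys : seq T) : V :=
  if xs is x :: xs' then
    \sum_(i < (size ys).+1) \sum_(k < (size ys - i).+1)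
      sgn R (dg x * (e + dsum (take i ys))) *:
      weave_sum (e + dsum (take (i + k) ys))
        (fun t => Phi (take i ys ++ B x (take k (drop i ys)) :: t))
        xs' (drop (i + k) ys)
  else Phi ys.

Lemma eq_weave_sum e Phi Psi xs ys : Phi =1 Psi -> weave_sum e Phi xs ys = weave_sum e Psi xs ys.
Proof.
elim: xs e Phi Psi ys => [|x xs IHxs] e Phi Psi ys h //=.
by do 2![apply: eq_bigr => ? _]; congr (_ *: _); apply: IHxs => t; apply: h.
Qed.

Lemma weave_sumD e Phi Psi xs ys :
  weave_sum e (fun t => Phi t + Psi t) xs ys = weave_sum e Phi xs ys + weave_sum e Psi xs ys.
Proof.
elim: xs e Phi Psi ys => [|x xs IHxs] e Phi Psi ys //=.
do 2![rewrite -big_split /=; apply: eq_bigr => ? _].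
by rewrite IHxs scalerDr.
Qed.

Lemma weave_sum0 e xs ys : weave_sum e (fun=> 0) xs ys = 0.
Proof.
elim: xs e ys => [|x xs IHxs] e ys //=.
by rewrite !big1 // => i _; rewrite big1 // => k _; rewrite IHxs scaler0.
Qed.

Lemma weave_sum_sum (I : Type) (r : seq I) e (Phi : I -> seq T -> V) xs ys :
  weave_sum e (fun t => \sum_(i <- r) Phi i t) xs ys = \sum_(i <- r) weave_sum e (Phi i) xs ys.
Proof.
elim: r => [|i r IHr].
  by rewrite big_nil -[RHS](weave_sum0 e xs ys); apply: eq_weave_sum => t; rewrite big_nil.
by rewrite big_cons -IHr -weave_sumD; apply: eq_weave_sum => t; rewrite big_cons.
Qed.

Lemma weave_sum_shift e Phi xs ys :
  weave_sum e Phi xs ys = sgn R (e * dsum xs) *: weave_sum 0 Phi xs ys.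
Proof.
elim: xs e Phi ys => [|x xs IHxs] e Phi ys /=; first by rewrite dsum_nil mulr0 sgn0 scale1r.
rewrite scaler_sumr; apply: eq_bigr => i _; rewrite scaler_sumr; apply: eq_bigr => k _.
rewrite IHxs [in RHS]IHxs !sgnZ; congr (_ *: _); apply: sgn_par.
rewrite dsum_cons !add0r; parity.
Qed.

Definition head_case (c : V) (G : T -> seq T -> V) (t : seq T) : V :=
  if t is z :: t' then G z t' else c.

(** The first entry of the woven list is the first y, or the brace of the first x
    with some initial segment of the ys, or there is no entry at all. In the
    first case y jumps over all the xs, in the second case the segment jumps
    over the xs which follow. *)
Lemma weave_sum_head c G xs ys :
  weave_sum 0 (head_case c G) xs ys =
  (if ys is y :: ys' then sgn R (dg y * dsum xs) *: weave_sum 0 (G y) xs ys' else 0) +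
  (if xs is x :: xs' then
    \sum_(k < (size ys).+1) sgn R (dsum (take k ys) * dsum xs') *:
      weave_sum 0 (G (B x (take k ys))) xs' (drop k ys) else 0) +
  (if xs is [::] then if ys is [::] then c else 0 else 0).
Proof.
case: xs => [|x xs].
  by case: ys => [|y ys] /=; rewrite ?addr0 ?add0r // dsum_nil mulr0 sgn0 scale1r.
rewrite addr0 [weave_sum _ _ _ _]/= big_ord_recl [X in X + _ = _]/= subn0 addrC; congr (_ + _).
  case: ys => [|y ys]; first by rewrite big_ord0.
  rewrite -weave_sum_shift /=; apply: eq_bigr => i _.
  rewrite dsum_cons; apply: eq_bigr => k _.
  by rewrite dsum_cons !add0r.
apply: eq_bigr => k _; rewrite weave_sum_shift sgnZ take0 drop0 dsum_nil !addr0 mulr0 add0r.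
by rewrite add0r add0n.
Qed.

End Weave.

(** * The brace relation for lists of homogeneous elements *)

Section Scan.
Variables (R : comPzRingType) (P : operad_data R).

(** A finite formal sum of elements of P of a common degree, which is recorded
    since the list may be empty. *)
Definition item := (int * seq (oel P))%type.
Implicit Types (x y : oel P) (ys : seq item).

(** The terms of the brace x{ys} when the inputs of x from position p on, N in
    number, are still to be read: the first of them is left alone, or receives a
    term of the first y, after which the next input to read comes after those of
    that term. *)
Fixpoint scan (p N : nat) x ys : seq (oel P) :=
  if N is N'.+1 then
    scan p.+1 N' x ys ++
    (if ys is y :: ys' then
       flatten [seq scan (p + arity a)%N N' (circ p x a) ys' | a <- y.2]
     else [::])
  else if ys is [::] then [:: x] else [::].

Definition homog (y : item) : bool := all (fun z => degree z == y.1) y.2.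

Lemma scan_sumS (V : zmodType) (F : oel P -> V) p N x ys :
  \sum_(v <- scan p N.+1 x ys) F v =
  \sum_(v <- scan p.+1 N x ys) F v +
  (if ys is y :: ys' then
     \sum_(a <- y.2) \sum_(v <- scan (p + arity a)%N N (circ p x a) ys') F v
   else 0).
Proof.
rewrite /= big_cat /=; congr (_ + _); case: ys => [|y ys]; first by rewrite big_nil.
by rewrite big_flatten /= big_map.
Qed.

Lemma scan_scale c p N x ys :
  scan p N (oelscale c x) ys = [seq oelscale c v | v <- scan p N x ys].
Proof.
elim: N p x ys => [|N IHN] p x ys /=; first by case: ys.
rewrite map_cat IHN; congr (_ ++ _); case: ys => [|y ys] //.
rewrite map_flatten -map_comp; congr flatten; apply: eq_map => a /=.
by rewrite circ_scalel IHN.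
Qed.

Lemma arity_circ_slot p N x a : arity x = (p + N.+1)%N ->
  arity (circ p x a) = (p + arity a + N)%N.
Proof. by rewrite arity_circ => ->; lia. Qed.

Lemma scan_arity p N x ys : arity x = (p + N)%N ->
  all (fun v => p <= arity v)%N (scan p N x ys).
Proof.
elim: N p x ys => [|N IHN] p x ys ex /=.
  by case: ys => //=; rewrite ex addn0 leqnn.
have mono q (s : seq (oel P)) : (p <= q)%N ->
    all (fun v => q <= arity v)%N s -> all (fun v => p <= arity v)%N s.
  by move=> le; apply: sub_all => v; apply: leq_trans.
rewrite all_cat (mono p.+1) ?IHN //=; last by rewrite ex addnS.
case: ys => [|y ys] //.
elim: y.2 => [|a s IHs] //=; rewrite all_cat IHs andbT.
by apply: mono (IHN _ _ _ _); [exact: leq_addr | exact: arity_circ_slot].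
Qed.

Hypothesis axP : operad_axioms P.

(** An insertion of a to the left of all the others can be made last: parallel
    associativity lets a pass each of the later insertions, at the price of
    one Koszul sign for each. *)
Lemma scan_commute p q N x a ys : (p < q)%N -> arity x = (q + N)%N -> all homog ys ->
  scan (q + arity a).-1 N (circ p x a) ys =
  [seq oelscale (sgn R (degree a * dsum fst ys)) (circ p w a) | w <- scan q N x ys].
Proof.
elim: N q x ys => [|N IHN] q x ys lt_pq ex hys.
  by case: ys hys => //= _; rewrite dsum_nil mulr0 sgn0 oelscale1.
rewrite /= map_cat; congr (_ ++ _).
  rewrite -IHN ?ex ?addnS ?ltnS ?(ltnW lt_pq) //.
  by congr (scan _ _ _ _); lia.
case: ys hys => [|y ys] //= /andP[hy hys].
rewrite map_flatten -map_comp; congr flatten; apply: eq_map_all hy _ => c /= /eqP dc.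
rewrite (circ_par axP); last by rewrite lt_pq ex; lia.
have -> : ((q + arity a).-1 + arity c = (q + arity c + arity a).-1)%N by lia.
rewrite scan_scale IHN //; first last.
- exact: arity_circ_slot.
- exact: ltn_addr.
rewrite -map_comp; apply: eq_map => w /=; rewrite oelscaleA -sgnD -mulrDr.
by rewrite dsum_cons dc.
Qed.

Variables (V : lmodType R).

(** A block of inputs can be read before the rest; the sum is over the number k
    of the ys which go into the first block. The position where the second
    reading starts depends on the arity of the result of the first one, and is
    recovered by counting the n2 inputs of the rest from the right end. *)
Lemma scan_split (F : oel P -> V) p n1 n2 x ys : arity x = (p + (n1 + n2))%N ->
  \sum_(v <- scan p (n1 + n2) x ys) F v =
  \sum_(k < (size ys).+1) \sum_(w <- scan p n1 x (take k ys))
    \sum_(v <- scan (arity w - n2) n2 w (drop k ys)) F v.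
Proof.
elim: n1 p x ys => [|n1 IHn] p x ys ex.
  rewrite big_ord_recl /= take0 drop0 big_seq1 ex addnK.
  rewrite [X in _ = _ + X]big1 ?addr0 // => k _.
  by case: ys k => [|y ys] k; [case: k | rewrite /= big_nil].
rewrite addSn scan_sumS IHn; last by rewrite ex; lia.
under [in RHS]eq_bigr => k _ do rewrite scan_sumS.
rewrite [in RHS]big_split /=; congr (_ + _).
case: ys => [|y ys]; first by rewrite big_ord_recl big_ord0 addr0.
rewrite [RHS]big_ord_recl /= add0r exchange_big /=; apply: eq_bigr => a _.
rewrite IHn //; apply: arity_circ_slot; rewrite ex; lia.
Qed.

(** Inserting xs to the right of a and then ys into the inputs of a amounts to
    inserting ys into a first. The statement allows that a has been read up to
    its input q, for the induction on the n inputs which are left. The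
    functional H has a natural number as an argument, the number of inputs of
    the composite to the right of those of a: it is the same on both sides, and
    it is needed to go on reading from there. *)
Lemma scan_exchange (H : nat -> oel P -> V) p N x a q n xs ys :
  (forall j c v, H j (oelscale c v) = c *: H j v) ->
  arity x = (p + N.+1)%N -> arity a = (q + n)%N -> all homog xs -> all homog ys ->
  \sum_(w <- scan (p + arity a) N (circ p x a) xs)
    \sum_(w' <- scan (p + q) n w ys) H (arity w - p - arity a)%N w' =
  sgn R (dsum fst ys * dsum fst xs) *:
  \sum_(u <- scan q n a ys) \sum_(w <- scan (p + arity u) N (circ p x u) xs)
    H (arity w - p - arity u)%N w.
Proof.
move=> HL ex + hxs; elim: n q a ys => [|n IHn] q a ys ea hys.
  case: ys hys => [|y ys] /= hys; last first.
    by rewrite big_nil scaler0; apply: big1_seq => w _; rewrite big_nil.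
  rewrite dsum_nil mul0r sgn0 scale1r big_seq1; apply: eq_bigr => w _.
  by rewrite big_seq1.
rewrite scan_sumS scalerDr; under eq_bigr => w _ do rewrite scan_sumS.
rewrite big_split /=; congr (_ + _).
  by rewrite -IHn // ?ea ?addnS.
case: ys hys => [|y ys] /= => [_|/andP[hy hys]]; first by rewrite scaler0 big1.
rewrite exchange_big /= scaler_sumr; apply: eq_big_all hy _ => c /eqP dc.
have eac := arity_circ_slot c ea.
transitivity (sgn R (degree c * dsum fst xs) *:
    \sum_(w <- scan (p + arity (circ q a c)) N (circ p x (circ q a c)) xs)
      \sum_(w' <- scan (p + (q + arity c)) n w ys) H (arity w - p - arity (circ q a c))%N w').
  rewrite -(circ_seq axP); [|by rewrite ex; lia|by rewrite ea; lia].
  have -> : (p + arity (circ q a c) = (p + arity a + arity c).-1)%N by rewrite eac ea; lia.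
  rewrite scan_commute //; first last.
  - exact: arity_circ_slot.
  - by rewrite ltn_add2l ea addnS ltnS leq_addr.
  rewrite big_map scaler_sumr.
  apply: (eq_big_all (scan_arity _ (arity_circ_slot a ex))) => w lew.
  rewrite scan_scale big_map scaler_sumr addnA; apply: eq_bigr => w' _.
  rewrite HL scalerA -sgnD arity_scale arity_circ eac ea.
  have -> : (arity w - p - (q + n.+1) = (arity w + arity c).-1 - p - (q + arity c + n))%N by lia.
  set s := (_ + _ : int); rewrite -[LHS]scale1r -(sgn0 R); congr (_ *: _).
  by apply: sgn_par; rewrite /s; parity.
rewrite IHn // sgnZ dsum_cons dc; congr (_ *: _).
by rewrite mulrDl.
Qed.

(** The brace b(y; ys) with all the inputs of y read from the beginning. *)
Definition brace_item (y : item) (ys : seq item) : item :=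
  (y.1 + dsum fst ys, flatten [seq scan 0 (arity z) z ys | z <- y.2]).

(** The brace relation. Both sides are decomposed according to what happens at
    the first unread input of x: it is left alone, it receives the first y, or it
    receives the first x. These are the three summands of [weave_sum_head] on the
    right. On the left the second one comes from inserting y after the xs, and
    needs [scan_commute]; the third one needs [scan_split] at the last input of
    the inserted x, followed by [scan_exchange]. *)
Lemma scan_brace (F : oel P -> V) p N x xs ys :
  (forall c v, F (oelscale c v) = c *: F v) ->
  arity x = (p + N)%N -> all homog xs -> all homog ys ->
  \sum_(w <- scan p N x xs) \sum_(v <- scan p (arity w - p) w ys) F v =
  weave_sum brace_item fst 0 (fun t => \sum_(v <- scan p N x t) F v) xs ys.
Proof.
move=> FL; elim: N p x xs ys => [|N IHN] p x xs ys ex hxs hys.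
  rewrite (@eq_weave_sum _ _ _ _ _ _ _ (head_case (F x) (fun _ _ => 0))); last first.
    by case=> [|z t] /=; rewrite ?big_seq1 ?big_nil.
  have Z e (t1 t2 : seq item) :
      weave_sum (R := R) brace_item fst e (fun=> 0 : V) t1 t2 = 0 by exact: weave_sum0.
  rewrite weave_sum_head.
  have -> : (if ys is y :: ys' then sgn R (y.1 * dsum fst xs) *:
      weave_sum (R := R) brace_item fst 0 (fun=> 0 : V) xs ys' else 0) = 0.
    by case: {hys} ys => [|y ys] //; rewrite Z scaler0.
  case: xs hxs => [|x1 xs] hxs.
    rewrite [scan _ _ _ _]/= big_seq1 ex addn0 subnn !add0r.
    by case: ys hys => [|y ys] hys /=; rewrite ?big_seq1 ?big_nil.
  rewrite [scan _ _ _ _]/= big_nil big1 ?addr0 // => k _.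
  by rewrite Z scaler0.
rewrite scan_sumS.
pose G z t : V := \sum_(a <- (z : item).2) \sum_(v <- scan (p + arity a) N (circ p x a) t) F v.
rewrite (@eq_weave_sum _ _ _ _ _ _ _
  (fun t => \sum_(v <- scan p.+1 N x t) F v + head_case 0 G t)); last first.
  by case=> [|z t]; rewrite scan_sumS.
rewrite weave_sumD weave_sum_head.
have ex1 : arity x = (p.+1 + N)%N by rewrite ex addnS.
rewrite -IHN //.
(* The xs are inserted to the right of the input p, which then reads ys. *)
have E1 w : (p < arity w)%N ->
    \sum_(v <- scan p (arity w - p) w ys) F v =
    \sum_(v <- scan p.+1 (arity w - p.+1) w ys) F v +
    if ys is y :: ys' then \sum_(a <- y.2)
      \sum_(v <- scan (p + arity a) (arity w - p.+1) (circ p w a) ys') F v else 0.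
  by move=> ltw; rewrite -subnSK // scan_sumS.
rewrite (eq_big_all (scan_arity xs ex1) E1) big_split /= -!addrA; congr (_ + _).
congr (_ + _).
  case: ys hys {E1} => [|y ys] /= => [_|/andP[hy hys]]; first by rewrite big1.
  rewrite exchange_big /= weave_sum_sum scaler_sumr; apply: eq_big_all hy _ => a /eqP da.
  rewrite -IHN //; last exact: arity_circ_slot.
  have -> : (p + arity a = (p.+1 + arity a).-1)%N by [].
  rewrite scan_commute // big_map scaler_sumr.
  apply: (eq_big_all (scan_arity xs ex1)) => w ltw.
  rewrite scan_scale big_map scaler_sumr arity_scale arity_circ.
  have -> : ((arity w + arity a).-1 - (p.+1 + arity a).-1 = arity w - p.+1)%N by lia.
  apply: eq_bigr => v _; rewrite FL sgnZ -[LHS]scale1r -(sgn0 R); congr (_ *: _).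
  by apply: sgn_par; rewrite da; parity.
case: xs hxs {E1} => [|x1 xs] /= => [_|/andP[hx hxs]].
  by rewrite add0r; case: ys {hys}.
(* The input p of x receives a term a of x1; the ys are split after its inputs. *)
rewrite addr0.
transitivity (\sum_(k < (size ys).+1) \sum_(a <- x1.2)
    \sum_(w <- scan (p + arity a) N (circ p x a) xs)
    \sum_(w' <- scan p (arity a) w (take k ys))
      \sum_(v <- scan (arity w' - (arity w - p - arity a)) (arity w - p - arity a) w'
                   (drop k ys)) F v).
  rewrite exchange_big /=; apply: eq_bigr => a _.
  rewrite exchange_big /=; apply: (eq_big_all (scan_arity _ (arity_circ_slot a ex))) => w lew.
  have -> : (arity w - p = arity a + (arity w - p - arity a))%N by lia.
  by rewrite scan_split; [apply: eq_bigr => k _; rewrite addKn | lia].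
apply: eq_bigr => k _; rewrite weave_sum_sum /brace_item /= big_flatten /= big_map scaler_sumr.
have [htk hdk] : all homog (take k ys) /\ all homog (drop k ys).
  by apply/andP; rewrite -all_cat cat_take_drop.
apply: eq_bigr => a _.
pose H j w : V := \sum_(v <- scan (arity w - j) j w (drop k ys)) F v.
have HL j c v : H j (oelscale c v) = c *: H j v.
  by rewrite /H scan_scale big_map scaler_sumr; apply: eq_bigr => ? _; rewrite FL.
have := @scan_exchange H p N x a 0 (arity a) xs (take k ys) HL ex erefl hxs htk.
rewrite addn0 => ->; congr (_ *: _); apply: eq_bigr => u _.
rewrite -IHN //; last exact: arity_circ_slot.
apply: (eq_big_all (scan_arity _ (arity_circ_slot u ex))) => w lew.
rewrite /H; congr (\sum_(v <- scan _ _ _ _) _); lia.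
Qed.

End Scan.

(** * From the definition of braces to lists of terms *)

Section BigTuple.
Variables (V : zmodType) (T : finType).

Lemma big_tuple0 (p : pred (seq T)) (F : 0.-tuple T -> V) :
  \sum_(w : 0.-tuple T | p w) F w = if p [::] then F [tuple] else 0.
Proof.
rewrite big_mkcond /= (eq_bigr (fun _ => if p [::] then F [tuple] else 0)).
  by rewrite sumr_const card_tuple expn0 mulr1n.
by move=> w _; rewrite tuple0.
Qed.

Lemma big_tupleS n (p : pred (seq T)) (F : n.+1.-tuple T -> V) :
  \sum_(w : n.+1.-tuple T | p w) F w =
  \sum_(x : T) \sum_(w : n.-tuple T | p (x :: w)) F [tuple of x :: w].
Proof.
rewrite pair_big_dep /=.
rewrite (reindex (fun xw : T * n.-tuple T => [tuple of xw.1 :: xw.2])) //=.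
exists (fun w => (thead w, [tuple of behead w])) => [[x w] _ | w _] /=.
  by rewrite theadE; congr (_, _); apply: val_inj.
by rewrite [RHS]tuple_eta.
Qed.

End BigTuple.

Lemma big_insertion_first (V : zmodType) m o (G : nat -> nat -> V) : (0 < o <= m.+1)%N ->
  \sum_(c : 'I_m.+2 * 'I_m.+1 | (o <= c.1)%N && (c.1 + c.2 <= m.+1)%N) G c.1 c.2 =
  \sum_(i < (m.+1 - o).+1) \sum_(k < (m.+1 - o - i).+1) G (o + i)%N k.
Proof.
case/andP=> o0 om.
rewrite -(pair_big_dep (fun i : 'I_m.+2 => (o <= i)%N)
  (fun (i : 'I_m.+2) (k : 'I_m.+1) => (i + k <= m.+1)%N) (fun i k => G i k)) /=.
rewrite -(big_geq_mkord o m.+2 xpredT (fun i => \sum_(k < m.+1 | (i + k <= m.+1)%N) G i k)).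
rewrite -{1}[o]add0n big_addn big_mkord subSn //; apply: eq_bigr => i _.
rewrite (big_ord_widen m.+1 (fun k => G (o + i)%N k)); last by lia.
rewrite addnC; apply: eq_bigl => k /=; have := ltn_ord i; lia.
Qed.

Lemma insertion_le m o c : insertion o m c -> (o <= m.+1)%N.
Proof.
elim: c o => [|[i k] c IHc] o //= /andP[oi /IHc]; lia.
Qed.

Section InsertionSum.
Variables (R : comPzRingType) (B : gmod R) (b : forall n, ghom B n.+1 0).
Variables (V : lmodType R) (ys : seq (hel B)).
Let m := size ys.

(** The sum over tuples of places in the brace relation is the recursive sum. The
    offset o counts the ys that have already been placed. *)
Lemma insertion_sum (Phi : seq (hel B) -> V) o xs : (0 < o <= m.+1)%N ->
  \sum_(c : (size xs).-tuple ('I_m.+2 * 'I_m.+1) | insertion o m (places c))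
    sgn R (\sum_(p < size xs) (degs xs)`_p *
             sdeg (take (nth 0%N (unzip1 (places c)) p).-1 ys)) *:
    Phi (weave b o xs (places c) ys) =
  weave_sum (bapp b) (@tag _ _) (sdeg (take o.-1 ys)) Phi xs (drop o.-1 ys).
Proof.
elim: xs o Phi => [|x xs IHxs] o Phi ho.
  rewrite (big_tuple0 (fun s => insertion o m [seq (val p.1, val p.2) | p <- s])) /=.
  by case/andP: ho => _ ->; rewrite big_ord0 sgn0 scale1r.
rewrite (big_tupleS (fun s => insertion o m [seq (val p.1, val p.2) | p <- s])) /=.
pose G i k := sgn R (tag x * sdeg (take i.-1 ys)) *:
  weave_sum (bapp b) (@tag _ _) (sdeg (take (i + k).-1 ys))
    (fun t => Phi (slice o (i - o) ys ++ bapp b x (slice i k ys) :: t)) xs (drop (i + k).-1 ys).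
transitivity (\sum_(c : 'I_m.+2 * 'I_m.+1 | (o <= c.1)%N && (c.1 + c.2 <= m.+1)%N) G c.1 c.2).
  rewrite [RHS]big_mkcond; apply: eq_bigr => -[i k] _ /=.
  case: (leqP o i) => oi /=; last by rewrite big_pred0_eq.
  case: leqP => ik; last first.
    by rewrite big1 // => c /insertion_le; lia.
  rewrite /G -IHxs; last by case/andP: ho; lia.
  rewrite scaler_sumr; apply: eq_bigr => c _.
  by rewrite sgnZ big_ord_recl.
rewrite big_insertion_first //; case/andP: ho => o0 om.
rewrite size_drop; have -> : (size ys - o.-1 = m.+1 - o)%N by rewrite /m; lia.
apply: eq_bigr => i _; apply: eq_bigr => k _; rewrite /G /dsum -!/(sdeg _).
have e j : (o + j).-1 = (o.-1 + j)%N by lia.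
rewrite -addnA !e !takeD !sdeg_cat drop_drop.
congr (_ *: _); rewrite drop_drop [(i + k + o.-1)%N]addnC; apply: eq_weave_sum => t.
by rewrite /slice addKn e [(i + o.-1)%N]addnC.
Qed.

End InsertionSum.

Lemma dprod_sumE (R : comPzRingType) (T I : Type) (V : T -> lmodType R) (r : seq I)
  (p : pred I) (F : I -> dprod V) t :
  (\sum_(i <- r | p i) F i : dprod V) t = \sum_(i <- r | p i) F i t.
Proof. by elim/big_rec2: _ => // i y1 y2 _ <-. Qed.

Section BraceScan.
Variables (R : comPzRingType) (P : operad_data R).
Hypothesis axP : operad_axioms P.
Local Notation helP := (hel (tot P)).

Definition singleton_item (z : oel P) : item P := (degree z, [:: z]).
Definition truncate (K : nat) (y : helP) : item P := (tag y, [seq ar a y | a <- iota 0 K]).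

Lemma big_truncate (V : zmodType) (F : oel P -> V) K (x : helP) :
  \sum_(z <- (truncate K x).2) F z = \sum_(a < K) F (ar a x).
Proof.
have -> : (truncate K x).2 = [seq ar a x | a <- index_iota 0 K] by rewrite /index_iota subn0.
by rewrite big_map big_mkord.
Qed.

(** A mask with units in the unused inputs is a choice of the inputs which
    receive the elements of s, and composing with a unit changes nothing. *)
Lemma mask_sum (V : zmodType) (F : oel P -> V) p M z (s : seq (oel P)) :
  arity z = (p + M)%N ->
  \sum_(w : M.-tuple bool | count id w == size s) F (gamma_from p z (with_units w s)) =
  \sum_(v <- scan p M z (map singleton_item s)) F v.
Proof.
elim: M p z s => [|M IHM] p z s ez.
  rewrite (big_tuple0 (fun w => count id w == size s)) /=.
  by case: s => [|c s] /=; rewrite ?big_seq1 ?big_nil.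
rewrite (big_tupleS (fun w => count id w == size s)) big_bool scan_sumS [RHS]addrC /=.
congr (_ + _).
  case: s => [|c s] /=; first by rewrite big_pred0_eq.
  rewrite big_seq1 -IHM; last exact: arity_circ_slot.
  by apply: eq_bigl => w; rewrite eqSS.
rewrite -IHM ?ez ?addnS //; apply: eq_bigr => w _ /=.
by rewrite addn0 circ_unit // ez; lia.
Qed.

(** Choosing one arity for each of the ys commutes with reading the inputs. *)
Lemma arity_sum (V : zmodType) (F : oel P -> V) K p M z n (ys : seq helP) : size ys = n ->
  \sum_(a : n.-tuple 'I_K) \sum_(v <- scan p M z
     (map singleton_item [seq ar (val q.2) q.1 | q <- zip ys a])) F v =
  \sum_(v <- scan p M z (map (truncate K) ys)) F v.
Proof.
elim: M p z n ys => [|M IHM] p z n ys sys.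
  case: ys sys => [|y ys] /= <-; last first.
    rewrite big_nil (big_tupleS xpredT) big1 // => a _; rewrite big1 // => c _ /=.
    by rewrite big_nil.
  by rewrite (big_tuple0 xpredT).
rewrite scan_sumS -(IHM _ _ n) //; under eq_bigr => a _ do rewrite scan_sumS.
rewrite big_split /=; congr (_ + _).
case: ys sys => [|y ys] /= <-; first by rewrite big1 // => -[[|c a] sa].
rewrite (big_tupleS xpredT) (big_truncate _ K y).
apply: eq_bigr => a _; rewrite -(IHM _ _ (size ys)) //.
by apply: eq_bigr => c _ /=; rewrite big_seq1.
Qed.

Lemma brace_part_scan n D N x (ys : seq helP) : size ys = n ->
  brace_part n D (x :: ys) N =
  \sum_(z <- (truncate (N + n).+1 x).2)
    \sum_(v <- scan 0 (arity z) z (map (truncate N.+1) ys)) opart P N D v.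
Proof.
move=> sys; rewrite /brace_part sys eqxx big_truncate.
apply: eq_bigr => a0 _; rewrite -(arity_sum _ _ _ _ _ sys); apply: eq_bigr => a _.
rewrite -(@mask_sum _ _ _ a0) //; apply: eq_bigl => w.
by rewrite size_map size_zip size_tuple sys minnn.
Qed.

(** A linear functional on elements of P which vanishes in arities above N only
    sees the components of a formal sum in arities up to N. This is what allows
    finite lists to stand for elements of the product over all arities. *)
Section Congruence.
Variables (V : lmodType R) (F : oel P -> V) (N : nat).

Definition oel_linear (G : oel P -> V) : Prop :=
  forall a w u v, lincomb a w u v -> G w = a *: G u + G v.
Definition vanish_above (G : oel P -> V) : Prop :=
  forall z, (N < arity z)%N -> G z = 0.

Lemma opart_ne n d (z : oel P) : tag z != (n, d) -> opart P n d z = 0 :> P n d.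
Proof. exact: (part_ne (V := oarp P)). Qed.

Lemma oel_linear0 G n d : oel_linear G -> G (oelt (0 : P n d)) = 0.
Proof.
move=> GL; have := GL (-1) (oelt (0 : P n d)) (oelt (0 : P n d)) (oelt (0 : P n d)).
rewrite scaleN1r addNr; apply.
by exists (n, d), 0, 0; split; rewrite // scaler0 addr0.
Qed.

Lemma sum_components (G : oel P -> V) (d : int) (l : seq (oel P)) :
  oel_linear G -> vanish_above G -> all (fun z => degree z == d) l ->
  \sum_(z <- l) G z =
  \sum_(u < N.+1) G (oelt (\sum_(z <- l) opart P (u : nat) d z : P u d)).
Proof.
move=> GL G0; elim: l => [|z l IHl] /= hl.
  rewrite big_nil big1 // => u _; rewrite big_nil; exact: oel_linear0.
case/andP: hl => /eqP dz hl; rewrite big_cons IHl //.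
have E (u : 'I_N.+1) : G (oelt (\sum_(y <- z :: l) opart P (u : nat) d y : P u d)) =
    G (oelt (opart P (u : nat) d z : P u d)) +
    G (oelt (\sum_(y <- l) opart P (u : nat) d y : P u d)).
  rewrite -[G (oelt (opart P (u : nat) d z : P u d))]scale1r; apply: GL.
  exists (nat_of_ord u, d), (opart P (u : nat) d z : P u d).
  exists (\sum_(y <- l) opart P (u : nat) d y : P u d); split=> //.
  by rewrite scale1r big_cons.
under [RHS]eq_bigr => u _ do rewrite E.
rewrite big_split /=; congr (_ + _).
have T (u : nat) : u != arity z -> opart P u d z = 0 :> P u d.
  by move=> ne; apply: opart_ne; apply: contraNneq ne => e; rewrite /arity e.
case: (ltnP N (arity z)) => h.
  rewrite G0 // big1 // => u _; rewrite T ?oel_linear0 //.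
  by have := ltn_ord u; lia.
rewrite (bigD1 (Ordinal (h : (arity z < N.+1)%N))) //= big1 ?addr0.
  congr (G _); rewrite -[LHS]oel_eta -dz; move: z {hl dz E T h} => [[n e] z] /=.
  congr (oelt _); exact: (esym (partE (V := oarp P) (i := (n, e)) z)).
move=> u ne; rewrite T ?oel_linear0 //; apply: contraNneq ne => e; exact/eqP/val_inj.
Qed.

Lemma eq_sum_components (G : oel P -> V) (d : int) (l l' : seq (oel P)) :
  oel_linear G -> vanish_above G ->
  all (fun z => degree z == d) l -> all (fun z => degree z == d) l' ->
  (forall u, (u <= N)%N -> \sum_(z <- l) opart P u d z = \sum_(z <- l') opart P u d z) ->
  \sum_(z <- l) G z = \sum_(z <- l') G z.
Proof.
move=> GL G0 hl hl' e; rewrite !(@sum_components _ d) //; apply: eq_bigr => u _.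
by rewrite e // -ltnS.
Qed.

Hypotheses (FL : oel_linear F) (F0 : vanish_above F).

Lemma scan_linear p M ys :
  oel_linear (fun z => \sum_(v <- scan p M z ys) F v).
Proof.
elim: M p ys => [|M IHM] p ys a w u v h.
  by case: ys => [|y ys] /=; rewrite ?big_seq1 ?big_nil ?scaler0 ?addr0 //; apply: FL.
rewrite !scan_sumS (IHM _ _ _ _ _ _ h) scalerDr addrACA; congr (_ + _).
case: ys => [|y ys]; first by rewrite scaler0 addr0.
rewrite scaler_sumr -big_split; apply: eq_bigr => c _.
exact/IHM/lincomb_circl.
Qed.

Lemma scan_linear_in q p M x ys :
  oel_linear (fun c => \sum_(v <- scan (p + arity c) M (circ q x c) ys) F v).
Proof.
move=> a w u v h.
have [ew ev] : arity w = arity u /\ arity v = arity u.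
  by case: h => -[n d] [y [y' [-> -> ->]]].
rewrite ew ev; exact/scan_linear/lincomb_circr.
Qed.

(** Each insertion lowers the arity by at most one, and only the unread inputs
    can receive something; so p + (M - size ys) bounds the arity of all the
    results from below. *)
Lemma scan_vanish p M z ys : arity z = (p + M)%N -> (N < p + (M - size ys))%N ->
  \sum_(v <- scan p M z ys) F v = 0.
Proof.
elim: M p z ys => [|M IHM] p z ys ez lt.
  case: ys lt => [|y ys] /=; rewrite ?big_nil // big_seq1 => lt.
  by apply: F0; rewrite ez; lia.
rewrite scan_sumS IHM ?add0r; [|by rewrite ez addnS|by lia].
case: ys lt => [|y ys] //= lt; apply: big1_seq => c _.
by apply: IHM; [exact: arity_circ_slot | lia].
Qed.

(** The list y is a stand-in for the family h up to the arity N. *)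
Definition represents (h : helP) (y : item P) : Prop :=
  [/\ y.1 = tag h, homog y &
    forall u, (u <= N)%N -> \sum_(z <- y.2) opart P u (tag h) z = (tagged h : dprod _) u].

Fixpoint represents_all (hs : seq helP) (ys : seq (item P)) : Prop :=
  match hs, ys with
  | h :: hs', y :: ys' => represents h y /\ represents_all hs' ys'
  | [::], [::] => True
  | _, _ => False
  end.

Lemma eq_scan_items p M z hs ys ys' : arity z = (p + M)%N ->
  represents_all hs ys -> represents_all hs ys' ->
  \sum_(v <- scan p M z ys) F v = \sum_(v <- scan p M z ys') F v.
Proof.
elim: M p z hs ys ys' => [|M IHM] p z hs ys ys' ez.
  by case: hs ys ys' => [|h hs] [|y ys] [|y' ys'].
move=> h1 h2; rewrite !scan_sumS (IHM _ _ hs ys ys') ?ez ?addnS //; congr (_ + _).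
case: hs ys ys' h1 h2 => [|h hs] [|y ys] [|y' ys'] //= [hy hys] [hy' hys'].
transitivity (\sum_(a <- y.2) \sum_(v <- scan (p + arity a) M (circ p z a) ys') F v).
  apply: eq_bigr => a _; apply: (IHM _ _ hs) => //; exact: arity_circ_slot.
case: hy hy' => [e1 e2 e3] [e1' e2' e3'].
apply: (@eq_sum_components _ (tag h)); first exact: scan_linear_in.
- by move=> c lt; apply: scan_vanish; [exact: arity_circ_slot | lia].
- by rewrite -e1.
- by rewrite -e1'.
by move=> u hu; rewrite e3 ?e3'.
Qed.

End Congruence.

Lemma represents_truncate N K h : (N < K)%N -> represents N h (truncate K h).
Proof.
move=> lt; split=> //.
  by rewrite /homog /= all_map; apply/allP => a _ /=.
move=> u hu; rewrite big_truncate (bigD1 (Ordinal (leq_ltn_trans hu lt))) //= big1 ?addr0.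
  exact: (partE (V := oarp P) (i := (u, tag h))).
move=> a ne; apply: opart_ne => /=; apply: contraNneq ne => -[e].
by apply/eqP/val_inj.
Qed.

Lemma represents_all_truncate N K hs : (N < K)%N ->
  represents_all N hs (map (truncate K) hs).
Proof. by move=> lt; elim: hs => //= h hs IHhs; split=> //; apply: represents_truncate. Qed.

Lemma represents_le N N' h y : (N' <= N)%N -> represents N h y -> represents N' h y.
Proof. by move=> le [? ? H]; split=> // u hu; apply: H; apply: leq_trans le. Qed.

Lemma represents_all_le N N' hs ys : (N' <= N)%N ->
  represents_all N hs ys -> represents_all N' hs ys.
Proof.
move=> le; elim: hs ys => [|h hs IHhs] [|y ys] //= [/(represents_le le) ? /IHhs].
by [].
Qed.

Lemma represents_size N hs ys : represents_all N hs ys -> size hs = size ys.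
Proof. by elim: hs ys => [|h hs IHhs] [|y ys] //= [_ /IHhs ->]. Qed.

Lemma represents_sdeg N hs ys : represents_all N hs ys -> dsum fst ys = sdeg hs.
Proof.
elim: hs ys => [|h hs IHhs] [|y ys] //=; first by rewrite dsum_nil /sdeg big_nil.
by case=> -[e _ _] /IHhs e'; rewrite dsum_cons sdeg_cons e e'.
Qed.

Lemma represents_homog N hs ys : represents_all N hs ys -> all (@homog R P) ys.
Proof. by elim: hs ys => [|h hs IHhs] [|y ys] //= [[_ -> _] /IHhs]. Qed.

Lemma represents_cat N hs ys hs' ys' : represents_all N hs ys ->
  represents_all N hs' ys' -> represents_all N (hs ++ hs') (ys ++ ys').
Proof. by elim: hs ys => [|h hs IHhs] [|y ys] //= [? /IHhs H] /H. Qed.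

Lemma represents_take N k hs ys : represents_all N hs ys ->
  represents_all N (take k hs) (take k ys).
Proof. by elim: hs k ys => [|h hs IHhs] [|k] [|y ys] //= [? /IHhs H]; split=> //; apply: H. Qed.

Lemma represents_drop N k hs ys : represents_all N hs ys ->
  represents_all N (drop k hs) (drop k ys).
Proof. by elim: hs k ys => [|h hs IHhs] [|k] [|y ys] //= [? /IHhs H]; apply: H. Qed.

Lemma opart_linear N D : oel_linear (fun v => opart P N D v : P N D).
Proof. by move=> a w u v; apply: lincomb_opart. Qed.

Lemma opart_vanish N D : vanish_above N (fun v => opart P N D v : P N D).
Proof.
move=> z lt; apply: opart_ne; apply: contraTneq lt => e.
by rewrite /arity e ltnn.
Qed.

(** The arity N of a brace of h with n arguments involves the arities of h up to
    N + n and those of the arguments up to N. *)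
Lemma brace_part_represents N D h hs y ys :
  represents (N + size hs) h y -> represents_all N hs ys ->
  brace_part (size hs) D (h :: hs) N =
  \sum_(z <- y.2) \sum_(v <- scan 0 (arity z) z ys) opart P N D v.
Proof.
move=> hy hys; rewrite brace_part_scan //.
transitivity (\sum_(z <- (truncate (N + size hs).+1 h).2)
    \sum_(v <- scan 0 (arity z) z ys) opart P N D v).
  apply: eq_bigr => z _.
  apply: (eq_scan_items (@opart_linear N D) (@opart_vanish N D)
    (z := z) (p := 0%N) (hs := hs)) => //.
  exact: represents_all_truncate.
case: hy (represents_truncate h (ltnSn (N + size hs))) => [e1 e2 e3] [e1' e2' e3'].
apply: (@eq_sum_components _ (N + size hs) _ (tag h)).
- move=> a w u v hl.
  have [ew ev] : arity w = arity u /\ arity v = arity u.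
    by case: hl => -[n d] [c [c' [-> -> ->]]].
  rewrite ew ev; apply: scan_linear hl; exact: opart_linear.
- move=> z lt; apply: (scan_vanish (@opart_vanish N D)) => //.
  by rewrite -(represents_size hys); lia.
- by rewrite -e1'.
- by rewrite -e1.
by move=> u hu; rewrite e3 ?e3'.
Qed.

Lemma scan_degree p M z ys : all (@homog R P) ys ->
  all (fun v => degree v == degree z + dsum fst ys) (scan p M z ys).
Proof.
elim: M p z ys => [|M IHM] p z ys hys /=.
  by case: ys hys => //= _; rewrite dsum_nil addr0 eqxx.
rewrite all_cat IHM //=; case: ys hys => [|y ys] //= /andP[+ hys].
rewrite /homog dsum_cons; elim: y.2 => [|c l IHl] //= /andP[/eqP dc hl].
rewrite all_cat IHl // andbT -dc addrA; exact: IHM.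
Qed.

Lemma bapp_represents N D h hs y ys :
  represents (N + size hs) h y -> represents_all N hs ys ->
  (dpart D (bapp (brace P) h hs) : tot P D) N =
  \sum_(z <- y.2) \sum_(v <- scan 0 (arity z) z ys) opart P N D v.
Proof.
move=> hy hys; have [<-|ne] := eqVneq (0 + sdeg (h :: hs)) D.
  by rewrite /bapp /happ partE; apply: brace_part_represents.
rewrite part_ne //; case: hy => [e1 e2 _].
rewrite (eq_big_all (G := fun=> 0) e2) ?big1 // => z /eqP dz.
apply: etrans (big1_eq _ _).
apply: (eq_big_all (scan_degree _ _ _ (represents_homog hys))) => v /eqP dv.
apply: opart_ne; apply: contraNneq ne => e; apply/eqP.
by rewrite sdeg_cons add0r -e1 -(represents_sdeg hys) -dz -dv /degree e.
Qed.

Lemma represents_bapp N h hs y ys :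
  represents (N + size hs) h y -> represents_all N hs ys ->
  represents N (bapp (brace P) h hs) (brace_item y ys).
Proof.
move=> hy hys.
have e : (brace_item y ys).1 = tag (bapp (brace P) h hs).
  case: hy => [e1 _ _].
  by rewrite /brace_item /= sdeg_cons add0r e1 (represents_sdeg hys).
split=> //.
  case: hy => [_ + _]; rewrite /homog /brace_item /=; elim: y.2 => //= z l IHl /andP[/eqP dz hl].
  rewrite all_cat IHl // andbT -dz; exact: (scan_degree _ _ _ (represents_homog hys)).
move=> u hu; rewrite /brace_item /= big_flatten /= big_map.
rewrite -(@bapp_represents u _ h hs) //; last exact: represents_all_le hys.
  by rewrite partE.
by apply: represents_le hy; lia.
Qed.

Lemma weave_sum_represents (V : lmodType R) N K e (Phi : seq helP -> V)
  (Phi' : seq (item P) -> V) hs hs' xs xs' : (N + size hs <= K)%N ->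
  represents_all K hs hs' -> represents_all K xs xs' ->
  (forall t t', (size t <= size xs + size hs)%N ->
     represents_all N t t' -> Phi t = Phi' t') ->
  weave_sum (bapp (brace P)) (@tag _ _) e Phi xs hs =
  weave_sum (@brace_item R P) fst e Phi' xs' hs'.
Proof.
elim: xs xs' e Phi Phi' hs hs' => [|x xs IHxs] [|x' xs'] e Phi Phi' hs hs' leK hhs //=.
  by move=> _ h; apply: h => //; apply: represents_all_le hhs; lia.
move=> [hx hxs] h; rewrite -(represents_size hhs).
have dE s s' : represents_all K s s' -> dsum (@tag _ _) s = dsum fst s'.
  by move=> /represents_sdeg ->.
have hN s s' : represents_all K s s' -> represents_all N s s'.
  by apply: represents_all_le; lia.
apply: eq_bigr => i _; apply: eq_bigr => k _.
rewrite (dE _ _ (represents_take i hhs)) (dE _ _ (represents_take (i + k) hhs)).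
have -> : tag x = x'.1 by case: hx.
congr (_ *: _); apply: IHxs => //; first by rewrite size_drop; lia.
  exact: represents_drop.
move=> t t' st ht; apply: h.
  by move: st; rewrite size_cat /= size_take_min size_drop; have := ltn_ord i; lia.
apply: represents_cat; first exact/hN/represents_take.
split=> //; apply: represents_bapp.
  by apply: represents_le hx; rewrite size_take_min size_drop; lia.
by apply/hN/represents_take/represents_drop.
Qed.

(** The identity is checked in each arity N. Truncating all the arguments above
    the arity N + n + m is harmless for both sides, and turns the identity into
    [scan_brace], summed over the terms of x. *)
Theorem brace_brace_algebra : brace_algebra (brace P).
Proof.
move=> x xs ys n m D; apply: functional_extensionality_dep => N.
rewrite [RHS]dprod_sumE.
rewrite (@insertion_sum R (tot P) (brace P) (P N D) ys
  (fun t => (dpart D (bapp (brace P) x t) : tot P D) N) 1 xs) //.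
rewrite /= take0 drop0 /sdeg big_nil.
pose K := (N + n + m)%N; pose tr := truncate K.+1.
rewrite (@weave_sum_represents _ N K _ _ (fun t => \sum_(z <- (tr x).2)
    \sum_(v <- scan 0 (arity z) z t) opart P N D v) _ (map tr ys) _ (map tr xs)); first last.
- move=> t t' st ht; apply: bapp_represents => //; apply: represents_truncate.
  by rewrite /K /n /m /=; lia.
- exact: represents_all_truncate.
- exact: represents_all_truncate.
- by rewrite /K /m /=; lia.
rewrite weave_sum_sum.
rewrite (@bapp_represents N D (bapp (brace P) x xs) ys
  (brace_item (tr x) (map tr xs)) (map tr ys)); first last.
- by apply: represents_all_truncate; rewrite /K /=; lia.
- apply: represents_bapp; last by apply: represents_all_truncate; rewrite /K /=; lia.
  by apply: represents_truncate; rewrite /K /n /m; lia.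
rewrite /brace_item big_flatten big_map; apply: eq_bigr => z _.
have hom s : all (@homog R P) (map tr s).
  exact: represents_homog (represents_all_truncate s (ltnSn K)).
rewrite -(scan_brace axP) //; last first.
- move=> c v; exact: (part_scale (V := oarp P) (N, D) c (tagged v)).
apply: eq_bigr => w _; by rewrite subn0.
Qed.

End BraceScan.

(** * Parities of the signs of the J-relations *)

(** In this part a list of integers is the list of the degrees of a list of
    elements. *)
Definition isum (d : seq int) : int := \sum_(v <- d) v.

Lemma isum_cons v d : isum (v :: d) = v + isum d.
Proof. by rewrite /isum big_cons. Qed.
Lemma isum_nil : isum [::] = 0.
Proof. by rewrite /isum big_nil. Qed.
Lemma isum_cat a d : isum (a ++ d) = isum a + isum d.
Proof. by rewrite /isum big_cat. Qed.
Lemma isum_nth d : isum d = \sum_(v < size d) d`_v.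
Proof. by rewrite /isum (big_nth 0) big_mkord. Qed.

(** The exponent of the sign in the evaluation of the j-fold tensor power of S:
    the sum of (j - i) |x_i|. *)
Fixpoint shift_sign (d : seq int) : int :=
  if d is v :: d' then (size d')%:Z * v + shift_sign d' else 0.

Lemma shift_signE d : shift_sign d = \sum_(i < size d) ((size d)%:Z - i.+1%:Z) * d`_i.
Proof.
elim: d => [|v d IHd] /=; first by rewrite big_ord0.
rewrite big_ord_recl IHd /=; congr (_ * _ + _); first by lia.
Qed.

Lemma shift_sign_cat a d : shift_sign (a ++ d) = shift_sign a + (size d)%:Z * isum a + shift_sign d.
Proof.
elim: a => [|v a IHa] /=; first by rewrite isum_nil mulr0 !add0r.
rewrite IHa isum_cons size_cat PoszD; ring.
Qed.

Lemma sum_slice a d c (f : nat -> int) :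
  \sum_((size a).+1 <= v < (size a).+1 + size d) nth 0 (0 :: a ++ d ++ c) v * f v =
  \sum_(v < size d) d`_v * f (size a + v).+1.
Proof.
rewrite -{1}[(size a).+1]add0n [in X in \big[_/_]_(_ <= _ < X) _]addnC big_addn addnK big_mkord.
apply: eq_bigr => v _; rewrite addnS /= addnC nth_cat ltnNge leq_addr /= addKn.
by rewrite nth_cat ltn_ord.
Qed.

Lemma par_double a b : par (a + 2 * b) = par a.
Proof. by rewrite parD parM addbF. Qed.

Lemma jlhs_signE d : jlhs_sign (size d) (nth 0 (0 :: d)) = shift_sign d.
Proof.
rewrite /jlhs_sign shift_signE big_add1 big_mkord; apply: eq_bigr => i _.
by [].
Qed.

Lemma sum_shift_sign a d c :
  \sum_(1 <= v < (size d).+1)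
    nth 0 (0 :: a ++ d ++ c) ((size a).+1 + v).-1 * ((size d)%:Z - v%:Z) = shift_sign d.
Proof.
rewrite big_add1 big_mkord shift_signE; apply: eq_bigr => v _.
by rewrite addnS /= nth_cat ltnNge leq_addr /= addKn nth_cat ltn_ord mulrC.
Qed.

(** The sign of relation (1) and the sign of the shift, for the entry of degree
    x + |s| which replaces the segment s, against the sign of the brace relation.
    The lists a, s, c are the degrees of the ys before, in and after the inner
    brace. *)
Lemma par_jeps1 (a s c : seq int) (x : int) :
  par (jeps1 (size (a ++ s ++ c)) (size s) (size a).+1 x (nth 0 (0 :: a ++ s ++ c))
       + shift_sign (a ++ (x + isum s) :: c)) =
  par (shift_sign (a ++ s ++ c) + x * isum a).
Proof.
rewrite /jeps1 sum_shift_sign.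
have := sum_slice [::] a (s ++ c) (fun=> x - (size s)%:Z + 1).
rewrite /= add1n => ->; rewrite -mulr_suml -isum_nth.
have -> : ((size (a ++ s ++ c)).+1 - size s)%N = (size a + size c).+1.
  by rewrite !size_cat; lia.
have -> : (size a + size c).+1%:Z - (size a).+1%:Z = (size c)%:Z by lia.
rewrite !shift_sign_cat /= !size_cat /= PoszD.
have -> : (size c).+1%:Z = (size c)%:Z + 1 by lia.
parity.
Qed.

Lemma par_jeta (a s c : seq int) :
  par (jeta (size (a ++ s ++ c)) (size s) (size a).+1 (nth 0 (0 :: a ++ s ++ c)) + shift_sign s) =
  par (shift_sign (a ++ s ++ c) + isum a).
Proof.
rewrite /jeta.
have -> : ((size (a ++ s ++ c)).+1 - size s)%N = (size a + size c).+1.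
  by rewrite !size_cat; lia.
have -> : ((size (a ++ s ++ c)) - size s).+1 = ((size a).+1 + size c)%N.
  by rewrite !size_cat; lia.
have E1 : \sum_(1 <= v < (size a).+1) ((size a + size c).+1%:Z - v%:Z) * nth 0 (0 :: a ++ s ++ c) v
   = shift_sign a + ((size c)%:Z + 1) * isum a.
  under eq_bigr => v _ do rewrite mulrC.
  have := sum_slice [::] a (s ++ c) (fun v => (size a + size c).+1%:Z - v%:Z).
  rewrite /= add1n => ->; rewrite shift_signE isum_nth mulr_sumr -big_split /=.
  by apply: eq_bigr => v _; rewrite add0n mulrC -mulrDl; congr (_ * _); lia.
have E2 : \sum_(1 <= v < (size a).+1) (size s)%:Z * nth 0 (0 :: a ++ s ++ c) v
   = (size s)%:Z * isum a.
  under eq_bigr => v _ do rewrite mulrC.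
  have := sum_slice [::] a (s ++ c) (fun v => (size s)%:Z).
  by rewrite /= add1n => ->; rewrite -mulr_suml -isum_nth mulrC.
have E3 : \sum_((size a).+1 <= v < (size a).+1 + size s)
    ((size a + size c).+1%:Z - (size a).+1%:Z) * nth 0 (0 :: a ++ s ++ c) v
   = (size c)%:Z * isum s.
  under eq_bigr => v _ do rewrite mulrC.
  rewrite (sum_slice a s c (fun=> (size a + size c).+1%:Z - (size a).+1%:Z)).
  by rewrite -mulr_suml -isum_nth mulrC; congr (_ * _); lia.
have E4 : \sum_((size a).+1 <= v < (size a).+1 + size c)
    ((size a + size c).+1%:Z - v%:Z - 1) * nth 0 (0 :: a ++ s ++ c) (v + size s)%N = shift_sign c.
  rewrite -{1}[(size a).+1]add0n [in X in \big[_/_]_(_ <= _ < X) _]addnC big_addn addnK big_mkord.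
  rewrite shift_signE; apply: eq_bigr => v _; congr (_ * _); first by lia.
  rewrite catA addnS addSn /= nth_cat size_cat ltnNge.
  have -> : (size a + size s <= v + size a + size s)%N by lia.
  by rewrite /=; congr nth; lia.
rewrite E1 E2 E3 E4 !shift_sign_cat !size_cat !PoszD; parity.
Qed.

(** The sign of the A_oo-relations together with the Koszul sign of the inner
    operation, which on the shift has degree 2 - q and passes a arguments of
    degree raised by one, leaves, up to the sign of the whole list, the sign of
    an operation of degree one which passes a. *)
Lemma par_ainf (a s c : seq int) (q := size s) :
  par ((size a * q + size c)%N%:Z + (2 - q%:Z) * (isum a + (size a)%:Z)
       + (shift_sign s + shift_sign (a ++ (1 + isum s) :: c))) =
  par (shift_sign (a ++ s ++ c) + isum a).
Proof.
rewrite /q !shift_sign_cat /= !size_cat PoszD PoszM.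
have -> : (size c).+1%:Z = (size c)%:Z + 1 by lia.
rewrite PoszD; have -> : (2 : int) = 1 + 1 by [].
parity.
Qed.

(** The exponent jeps2 modulo 2, after the following simplification. For w fixed
    all the terms with the factor A_w = X_w - K_w + 1 and an index t < w add up
    to A_w times the sum over t of the Y_v in the interval from I_t to I_(t+1),
    plus twice the length of that interval. So they contribute A_w times the
    degree of the ys before I_w. The sum of the differences
    I_(w+1) - I_w - K_w telescopes. *)
Fixpoint insertion_sign (n : nat) (d xs : seq int) (c : seq (nat * nat)) : int :=
  match xs, c with
  | x :: xs', (i, k) :: c' =>
      shift_sign (take k (drop i.-1 d))
      + x * (n.+1%:Z - i%:Z - k%:Z - (sumn (unzip2 c'))%:Z)
      + (x - k%:Z + 1) * isum (take i.-1 d) + insertion_sign n d xs' c'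
  | _, _ => 0
  end.

Fixpoint weave_degs (o : nat) (xs : seq int) (c : seq (nat * nat)) (d : seq int) : seq int :=
  match xs, c with
  | x :: xs', (i, k) :: c' =>
      slice o (i - o) d ++ (x + isum (slice i k d)) :: weave_degs (i + k)%N xs' c' d
  | _, _ => drop o.-1 d
  end.

Lemma size_weave_degs o xs c d : (0 < o)%N -> size xs = size c -> insertion o (size d) c ->
  (size (weave_degs o xs c d))%:Z = (size d).+1%:Z - o%:Z - (sumn (unzip2 c))%:Z + (size xs)%:Z.
Proof.
elim: xs o c => [|x xs IHxs] o [|[i k] c] //= o0.
  by move=> _ h; rewrite size_drop; lia.
case=> sc /andP[oi h]; have hik := insertion_le h.
rewrite size_cat /= /slice size_takel ?size_drop; last by lia.
have := IHxs (i + k)%N c; rewrite sc => /(_ _ erefl h) H.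
rewrite addnS -addSn PoszD H; [lia|lia].
Qed.

(** The sign of the shift on the woven list, in terms of the one on the ys, the
    one on the xs, the sign of the brace relation and jeps2. The last summand
    corrects for the ys before the offset o, which are absent from the woven list
    but counted in the two sums; it vanishes for o = 1. *)
Lemma par_weave_degs o xs c d : (0 < o)%N -> size xs = size c -> insertion o (size d) c ->
  par (shift_sign (weave_degs o xs c d)) =
  par (shift_sign (drop o.-1 d) + shift_sign xs
       + \sum_(p < size xs) xs`_p * isum (take (nth 0%N (unzip1 c) p).-1 d)
       + insertion_sign (size d) d xs c
       + (size xs + sumn (unzip2 c))%N%:Z * isum (take o.-1 d)).
Proof.
elim: xs o c => [|x xs IHxs] o [|[i k] c] //= o0.
  by move=> _ _; rewrite big_ord0 mul0r !addr0.
case=> sc /andP[oi h]; have hik := insertion_le h.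
have o1 : (0 < i + k)%N by lia.
have sW := size_weave_degs o1 sc h.
rewrite big_ord_recl /=.
set ep := \sum_(p < size xs) _.
have {IHxs} := IHxs _ _ o1 sc h; rewrite -/ep => IH.
have sd : (i.-1 = o.-1 + (i - o))%N by lia.
have sd' : ((i + k).-1 = o.-1 + (i - o) + k)%N by lia.
have eA : slice o (i - o) d = take (i - o) (drop o.-1 d) by [].
have eS : slice i k d = take k (drop (i - o) (drop o.-1 d)).
  by rewrite /slice drop_drop addnC -sd.
have eC : drop (i + k).-1 d = drop k (drop (i - o) (drop o.-1 d)).
  by rewrite !drop_drop sd'; congr drop; lia.
have eP : isum (take i.-1 d) = isum (take o.-1 d) + isum (slice o (i - o) d).
  by rewrite sd takeD isum_cat.
have eP' : isum (take (i + k).-1 d) =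
    isum (take o.-1 d) + isum (slice o (i - o) d) + isum (slice i k d).
  by rewrite sd' !takeD !isum_cat eS drop_drop [(o.-1 + _)%N]addnC.
have eD : drop o.-1 d = slice o (i - o) d ++ slice i k d ++ drop (i + k).-1 d.
  by rewrite eA eS eC !cat_take_drop.
rewrite eD !shift_sign_cat /= -/(slice i k d) parD [in LHS]parD [in LHS]parD IH.
rewrite [isum (take i.-1 d)]eP eP' [(size (_ :: _))%:Z]/= !size_cat.
rewrite size_takel; last by rewrite size_drop; lia.
rewrite size_drop !PoszD.
have -> : (size (weave_degs (i + k) xs c d)).+1%:Z =
    (size (weave_degs (i + k) xs c d))%:Z + 1 by lia.
rewrite sW.
have -> : (size d - (i + k).-1)%N%:Z = (size d).+1%:Z - (i%:Z + k%:Z) by lia.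
rewrite sc !PoszD.
have -> : (size c).+1%:Z = (size c)%:Z + 1 by lia.
have -> : (size d).+1%:Z = (size d)%:Z + 1 by lia.
set u1 := isum (slice o _ _); set u2 := isum (slice i _ _); set u3 := isum (take _ _).
set u4 := shift_sign (slice o _ _); set u5 := shift_sign (slice i _ _).
set u6 := shift_sign (drop _ _); set u7 := shift_sign xs; set u8 := insertion_sign _ _ _ _.
parity.
Qed.

Lemma insertion_weaken o o' m c : (o <= o')%N -> insertion o' m c -> insertion o m c.
Proof.
by case: c => [|[i k] c] /= le; [exact: leq_trans | case/andP=> /(leq_trans le) ->].
Qed.

Lemma insertion_mono o m c t : insertion o m c -> (t <= size c)%N ->
  (nth 0 (o :: rcons (unzip1 c) m.+1) t <= nth 0 (o :: rcons (unzip1 c) m.+1) t.+1)%N.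
Proof.
elim: c o t => [|[i k] c IHc] o [|t] //=; first by case/andP.
by case/andP=> _ /(insertion_weaken (leq_addr k i)) h; apply: IHc.
Qed.

Lemma exchange_triangle (V : zmodType) j (f : nat -> nat -> V) :
  \sum_(0 <= t < j) \sum_(t.+1 <= w < j.+1) f t w =
  \sum_(1 <= w < j.+1) \sum_(0 <= t < w) f t w.
Proof.
elim: j => [|j IHj]; first by rewrite !big_geq.
rewrite big_nat_recr // [RHS]big_nat_recr //= -IHj [X in _ + X]big_nat1.
rewrite [X in _ = _ + X]big_nat_recr //= addrA -big_split /=; congr (_ + _).
by apply: eq_big_nat => t /andP[_ lt]; rewrite [LHS]big_nat_recr //= ltnS ltnW.
Qed.

Lemma telescope_insertion N c :
  \sum_(0 <= w < size c) ((nth 0%N (rcons (unzip1 c) N) w.+1)%:Z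
     - (nth 0%N (rcons (unzip1 c) N) w)%:Z - (nth 0%N (unzip2 c) w)%:Z) =
  N%:Z - (nth 0%N (rcons (unzip1 c) N) 0)%:Z - (sumn (unzip2 c))%:Z.
Proof.
elim: c => [|[i k] c IHc]; first by rewrite big_geq //= subrr subr0.
rewrite /= big_nat_recl // IHc PoszD /=; ring.
Qed.

Lemma sum_prefix i (d : seq int) : (i <= size d)%N ->
  \sum_(0 <= v < i.+1) nth 0 (0 :: d) v = isum (take i d).
Proof.
move=> le; rewrite big_nat_recl //= add0r isum_nth size_takel // big_mkord.
by apply: eq_bigr => v _; rewrite nth_take.
Qed.

(** The index p counts the xs from 0, and the list of the I is followed by the
    conventional last entry n + 1. *)
Lemma insertion_signE o (xs : seq int) c (d : seq int) (Y := nth 0 (0 :: d))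
    (I := nth 0%N (rcons (unzip1 c) (size d).+1)) (K := nth 0%N (unzip2 c)) :
  (0 < o)%N -> size xs = size c -> insertion o (size d) c ->
  \sum_(p < size xs)
    (\sum_(1 <= v < (K p).+1) Y (I p + v).-1 * ((K p)%:Z - v%:Z)
     + xs`_p * \sum_(p <= w < size xs) ((I w.+1)%:Z - (I w)%:Z - (K w)%:Z)
     + (xs`_p - (K p)%:Z + 1) * \sum_(0 <= v < I p) Y v) =
  insertion_sign (size d) d xs c.
Proof.
rewrite {}/I {}/K {}/Y; elim: xs o c => [|x xs IHxs] o [|[i k] c] //=; first by rewrite big_ord0.
move=> o0 [sc] /andP[oi h]; have hik := insertion_le h.
have o1 : (0 < i + k)%N by lia.
rewrite big_ord_recl -(IHxs _ _ o1 sc h) /=; congr (_ + _ + _ + _); last first.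
- apply: eq_bigr => p _; congr (_ + _ + _).
  by rewrite /bump /= add1n big_add1.
- by congr (_ * _); have := @sum_prefix i.-1 d; rewrite prednK => [->|]; rewrite ?mulr1 //; lia.
- have := telescope_insertion (size d).+1 ((i, k) :: c).
  rewrite /= sc PoszD => ->; congr (_ * _); ring.
have e : size (take i.-1 d) = i.-1 by rewrite size_takel; lia.
have e' : size (take k (drop i.-1 d)) = k by rewrite size_takel // size_drop; lia.
have := sum_shift_sign (take i.-1 d) (take k (drop i.-1 d)) (drop k (drop i.-1 d)).
by rewrite !cat_take_drop e e' prednK //; lia.
Qed.

Lemma par_jeps2 (xs d : seq int) c : size xs = size c -> insertion 1 (size d) c ->
  par (jeps2 (size xs) (nth 0 (0 :: xs)) (nth 0 (0 :: d))
         (nth 0%N (0%N :: rcons (unzip1 c) (size d).+1)) (nth 0%N (0%N :: unzip2 c))) =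
  par (insertion_sign (size d) d xs c).
Proof.
move=> sc h; rewrite /jeps2; set j := size xs.
set X := nth 0 (0 :: xs); set Y := nth 0 (0 :: d).
set I := nth 0%N (0%N :: rcons _ _); set K := nth 0%N (0%N :: unzip2 c).
pose A w := X w - (K w)%:Z + 1.
pose g t : int := \sum_(I t <= v < I t.+1) (Y v + 1)
  + ((I t.+1)%:Z - (I t)%:Z - (K t)%:Z) + (K t)%:Z.
have E2 : \sum_(1 <= v < j.+1) \sum_(v.+1 <= w < j.+1) (K v)%:Z * (X w - (K w)%:Z + 1) =
    \sum_(0 <= v < j) \sum_(v.+1 <= w < j.+1) (K v)%:Z * A w.
  transitivity (\sum_(0 <= v < j.+1) \sum_(v.+1 <= w < j.+1) (K v)%:Z * A w).
    by rewrite [RHS]big_ltn // [X in _ = X + _]big1 ?add0r // => w _; rewrite mul0r.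
  by rewrite big_nat_recr //= [X in _ + X]big_geq ?addr0.
have mono t : (t <= j)%N -> (I t <= I t.+1)%N.
  by move=> le; apply: (insertion_mono (insertion_weaken (leq0n 1) h)); rewrite -sc.
(* The lengths of the intervals occur twice, once from the summand 1 of Y v + 1
   and once from the difference I (t + 1) - I t. *)
have E w : (w <= j)%N -> \sum_(0 <= t < w) g t = \sum_(0 <= v < I w) Y v + 2 * (I w)%:Z.
  elim: w => [|w IHw] lew; first by rewrite !big_geq // mulr0.
  rewrite big_nat_recr //= IHw ?(ltnW lew) //.
  rewrite [in RHS](big_cat_nat (n := I w)) //=; last exact/mono/ltnW.
  rewrite /g big_split /= sumr_const_nat natrB ?mono ?(ltnW lew) // !natz.
  by ring.
have E245 : \sum_(1 <= v < j.+1) \sum_(v.+1 <= w < j.+1) (K v)%:Z * (X w - (K w)%:Z + 1)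
    + \sum_(0 <= t < j) \sum_(t.+1 <= w < j.+1) \sum_(I t <= v < I t.+1)
        (Y v + 1) * (X w - (K w)%:Z + 1)
    + \sum_(0 <= v < j) \sum_(v.+1 <= w < j.+1)
        ((I v.+1)%:Z - (I v)%:Z - (K v)%:Z) * (X w - (K w)%:Z + 1)
    = \sum_(1 <= w < j.+1) A w * (\sum_(0 <= v < I w) Y v) +
      2 * \sum_(1 <= w < j.+1) A w * (I w)%:Z.
  rewrite E2 -!big_split /=.
  transitivity (\sum_(0 <= t < j) \sum_(t.+1 <= w < j.+1) g t * A w).
    apply: eq_bigr => t _; rewrite -!big_split /=; apply: eq_bigr => w _.
    by rewrite -mulr_suml /g; rewrite -/(A w); ring.
  rewrite exchange_triangle mulr_sumr -big_split /=; apply: eq_big_nat => w /andP[_ lew].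
  by rewrite -mulr_suml E //; ring.
set s1 := (X in X + _ + _ + _ + _); set s3 := (X in _ + _ + X + _ + _).
move: E245; set s2 := (X in X + _ + _ = _); set s4 := (X in _ + X + _ = _).
set s5 := (X in _ + X = _); move=> E245.
have -> : s1 + s2 + s3 + s4 + s5 = s1 + s3 + (s2 + s4 + s5) by ring.
rewrite E245 addrA par_double -(insertion_signE _ sc h) //; congr par.
rewrite /s1 /s3 !big_add1 /= -!big_split /= big_mkord; apply: eq_bigr => p _.
rewrite /A /= -mulr_sumr; congr (_ + _ + _).
by rewrite big_add1.
Qed.

(** * Evaluation on the shift *)

Section Shift.
Variables (R : comPzRingType) (B : gmod R).

Lemma shSK : cancel (@shS R B) (@shSinv R B).
Proof.
case=> d u; rewrite /shSinv /shS /=.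
by move: (esym (addrK 1 d)); move: (d + 1 - 1) => d' e; subst d'.
Qed.

Lemma shSinvK : cancel (@shSinv R B) (@shS R B).
Proof.
case=> d u.
have e : tag (shS (shSinv (Tagged (gshift B) u))) = d by rewrite /= subrK.
rewrite -[LHS](part_eq e) part_shS; congr (Tagged _ _).
exact: (partE (V := B) (i := d - 1)).
Qed.

Lemma shSinv_scale a (x : hel (gshift B)) : shSinv (hscale a x) = hscale a (shSinv x).
Proof. by []. Qed.

Lemma part_hscale (A : gmod R) D a (x : hel A) : dpart D (hscale a x) = a *: dpart D x.
Proof. by case: x => d x; rewrite /hscale /= part_scale. Qed.

Lemma sdeg_degs (A : gmod R) (xs : seq (hel A)) : sdeg xs = isum (degs xs).
Proof. by rewrite /sdeg /isum big_map. Qed.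

Lemma sdeg_shS (zs : seq (hel B)) : sdeg (map (@shS R B) zs) = sdeg zs + (size zs)%:Z.
Proof.
elim: zs => [|z zs IHzs]; first by rewrite /sdeg !big_nil.
rewrite /= !sdeg_cons IHzs /=; lia.
Qed.

Lemma happ_shifted j (f : ghom B j 1) zs : size zs = j ->
  happ (shifted f) (map (@shS R B) zs) = hscale (sgn R (shift_sign (degs zs))) (shS (happ f zs)).
Proof.
move=> sz; set T := (2 - j%:Z + sdeg (map (@shS R B) zs)).
have e1 : tag (happ (shifted f) (map (@shS R B) zs)) = T by [].
have e2 : tag (hscale (sgn R (shift_sign (degs zs))) (shS (happ f zs))) = T.
  by rewrite /T sdeg_shS /= sz; lia.
rewrite -(part_eq e1) -(part_eq e2); congr (Tagged _ _).
rewrite part_hscale /happ partE /shifted /= /shift_part mapK; last exact: shSK.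
by rewrite shift_signE size_map sz.
Qed.

End Shift.

Section Ranges.
Variables (V : zmodType) (n : nat) (G : nat -> nat -> V).

Lemma sum_pairs :
  \sum_(i < n.+1) \sum_(k < (n - i).+1) G i k =
  \sum_(i < n.+1) \sum_(k < n.+1 | (i + k <= n)%N) G i k.
Proof.
apply: eq_bigr => i _; rewrite (big_ord_widen n.+1 (fun k => G i k)) ?ltnS ?leq_subr //.
by apply: eq_bigl => k; have := ltn_ord i; lia.
Qed.

Lemma sum_pairs_nat a :
  \sum_(a <= k < n.+1) \sum_(1 <= i < (n - k).+2) G i.-1 k =
  \sum_(i < n.+1) \sum_(k < n.+1 | (a <= k)%N && (i + k <= n)%N) G i k.
Proof.
rewrite big_geq_mkord /=.
transitivity (\sum_(k < n.+1 | (a <= k)%N) \sum_(i < n.+1 | (i + k <= n)%N) G i k).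
  apply: eq_bigr => k _; rewrite big_add1 /= big_mkord.
  rewrite (big_ord_widen n.+1 (fun i => G i k)) ?ltnS ?leq_subr //.
  by apply: eq_bigl => i; have := ltn_ord k; lia.
by rewrite (exchange_big_dep xpredT).
Qed.

End Ranges.

(** * The J-algebra of a brace algebra with a square-zero element of degree one *)

Section BraceAlgebraWithSquareZero.
Variables (R : comPzRingType) (B : gmod R) (b : forall n, ghom B n.+1 0) (m : hel B).
Hypothesis bA : brace_algebra b.
Hypothesis b_nil : forall x, bapp b x [::] = x.
Hypothesis m1 : tag m = 1.
Hypothesis mm : forall D, dpart D (bapp b m [:: m]) = 0.

Local Notation bb := (bapp b).

Lemma tag_bb x ys : tag (bb x ys) = tag x + sdeg ys.
Proof. by rewrite /= add0r sdeg_cons. Qed.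

Lemma brace_at D x xs ys : D = tag x + sdeg xs + sdeg ys ->
  dpart D (bb (bb x xs) ys) =
  \sum_(c : (size xs).-tuple ('I_(size ys).+2 * 'I_(size ys).+1)
         | insertion 1 (size ys) (places c))
    sgn R (\sum_(p < size xs) (degs xs)`_p * sdeg (take (nth 0%N (unzip1 (places c)) p).-1 ys)) *:
    dpart D (bb x (weave b 1 xs (places c) ys)).
Proof. by move=> ->; exact: bA. Qed.

Lemma brace_weave_sum D x xs ys : D = tag x + sdeg xs + sdeg ys ->
  dpart D (bb (bb x xs) ys) =
  weave_sum bb (@tag _ _) 0 (fun t => dpart D (bb x t)) xs ys.
Proof.
move=> ->; rewrite (bA x xs ys).
rewrite (@insertion_sum R B b _ ys (fun t => dpart _ (bb x t)) 1 xs) //.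
by rewrite /= take0 drop0 /sdeg big_nil.
Qed.

Lemma brace_single D x y ys : D = tag x + tag y + sdeg ys ->
  dpart D (bb (bb x [:: y]) ys) =
  \sum_(i < (size ys).+1) \sum_(k < (size ys).+1 | (i + k <= size ys)%N)
    sgn R (tag y * sdeg (take i ys)) *:
    dpart D (bb x (take i ys ++ bb y (take k (drop i ys)) :: drop (i + k) ys)).
Proof.
move=> eD; rewrite brace_weave_sum /=; last by rewrite sdeg_cons /sdeg big_nil addr0.
rewrite -(sum_pairs (size ys) (fun i k => sgn R (tag y * sdeg (take i ys)) *:
    dpart D (bb x (take i ys ++ bb y (take k (drop i ys)) :: drop (i + k) ys)))).
by do 2!apply: eq_bigr => ? _; rewrite add0r.
Qed.

Lemma weave_sum_nil (V : lmodType R) e (Phi : seq (hel B) -> V) xs :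
  weave_sum bb (@tag _ _) e Phi xs [::] = sgn R (e * sdeg xs) *: Phi xs.
Proof.
elim: xs e Phi => [|x xs IHxs] e Phi /=.
  by rewrite /sdeg big_nil mulr0 sgn0 scale1r.
rewrite !big_ord1 dsum_nil !addr0 IHxs sgnZ b_nil sdeg_cons /=; congr (sgn _ _ *: _).
ring.
Qed.

(** One element m of degree 1 is inserted either between the xs or into one of
    them, and is passed by the xs which stand to its right. The second sum is
    written with a segment of length one of xs, so that it is literally the extra
    term of M'_1. *)
Lemma weave_sum_last (V : lmodType R) (Phi : seq (hel B) -> V) xs :
  weave_sum bb (@tag _ _) 0 Phi xs [:: m] =
  \sum_(i < (size xs).+1) sgn R (sdeg (drop i xs)) *: Phi (take i xs ++ m :: drop i xs) +
  \sum_(i < size xs) sgn R (sdeg (drop i.+1 xs)) *: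
    Phi (take i xs ++ happ (b 1%N) (rcons (take 1 (drop i xs)) m) :: drop i.+1 xs).
Proof.
elim: xs Phi => [|x xs IHxs] Phi.
  by rewrite big_ord1 big_ord0 addr0 /= /sdeg big_nil sgn0 scale1r.
rewrite (@eq_weave_sum _ _ _ _ _ _ _
  (head_case (Phi [::]) (fun z t => Phi (z :: t)))); last by case.
rewrite weave_sum_head addr0 m1 mul1r.
rewrite [size [:: m]]/= big_ord_recl big_ord1 [nat_of_ord _]/=.
rewrite take0 drop0 b_nil dsum_nil mul0r sgn0 scale1r.
rewrite IHxs !weave_sum_nil !mul0r !sgn0 !scale1r.
have -> : take (lift ord0 ord0 : 'I_2) [:: m] = [:: m] by [].
have -> : dsum (@tag _ _) [:: m] = 1 by rewrite dsum_cons dsum_nil m1 addr0.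
rewrite mul1r.
rewrite [X in _ = X + _]big_ord_recl [X in _ = _ + X]big_ord_recl /= -!addrA.
congr (_ + (_ + _)); rewrite addrC; congr (_ + _).
by rewrite drop0 take0.
Qed.

Lemma brace_last D x ys : D = tag x + sdeg ys + 1 ->
  dpart D (bb (bb x ys) [:: m]) =
  \sum_(i < (size ys).+1)
    sgn R (sdeg (drop i ys)) *: dpart D (bb x (take i ys ++ m :: drop i ys)) +
  \sum_(i < size ys) sgn R (sdeg (drop i.+1 ys)) *:
    dpart D (bb x (take i ys ++ happ (b 1%N) (rcons (take 1 (drop i ys)) m) :: drop i.+1 ys)).
Proof.
move=> eD; rewrite brace_weave_sum ?weave_sum_last //.
by rewrite [sdeg [:: m]]sdeg_cons m1 /sdeg big_nil addr0.
Qed.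

(** The map M'_j on lists of any length j. *)
Definition induced_app zs : hel B := happ (induced b m (size zs)) zs.

Lemma tag_induced_app zs : tag (induced_app zs) = 1 + sdeg zs.
Proof. by []. Qed.

Lemma sdeg_rcons zs : sdeg (rcons zs m) = 1 + sdeg zs.
Proof. by rewrite -cats1 sdeg_cat sdeg_cons m1 /sdeg big_nil addr0 addrC. Qed.

(** The list [rcons zs m] makes sense for zs of any length, so the extra term of
    M'_1 needs no name for the element of zs. *)
Lemma part_induced_app D zs : (0 < size zs)%N ->
  dpart D (induced_app zs) = dpart D (bb m zs) -
    (if size zs == 1%N then sgn R (sdeg zs) *: dpart D (happ (b 1%N) (rcons zs m)) else 0).
Proof.
move=> sz; have [<-|ne] := eqVneq (1 + sdeg zs) D; last first.
  rewrite !part_ne ?tag_bb ?m1 //; first by case: eqP; rewrite ?scaler0 subr0.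
  by rewrite /= sdeg_rcons add0r.
rewrite /induced_app /happ partE /= /bapp.
by case: zs sz => [|z [|z' zs]] //= _; rewrite subr0.
Qed.

Lemma induced_app_slot D n k (f : ghom B n k) s1 s2 w : (0 < size w)%N ->
  dpart D (happ f (s1 ++ induced_app w :: s2)) = dpart D (happ f (s1 ++ bb m w :: s2)) -
    (if size w == 1%N then
       sgn R (sdeg w) *: dpart D (happ f (s1 ++ happ (b 1%N) (rcons w m) :: s2)) else 0).
Proof.
move=> sw.
have h a : dpart (1 + sdeg w) (induced_app w) =
     a *: dpart (1 + sdeg w) (happ (b 1%N) (rcons w m)) + dpart (1 + sdeg w) (bb m w) ->
   dpart D (happ f (s1 ++ induced_app w :: s2)) =
     a *: dpart D (happ f (s1 ++ happ (b 1%N) (rcons w m) :: s2))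
     + dpart D (happ f (s1 ++ bb m w :: s2)).
  move=> e; apply: (@hom_lin_at _ _ _ _ _ _ _ _ (1 + sdeg w)) => //.
    by rewrite /= add0r sdeg_rcons.
  by rewrite tag_bb m1.
have := part_induced_app (1 + sdeg w) sw; case: eqP => _ e.
  apply: etrans (h (- sgn R (sdeg w)) _) _; last by rewrite scaleNr [LHS]addrC.
  by rewrite e scaleNr [LHS]addrC.
apply: etrans (h 0 _) _; last by rewrite scale0r add0r subr0.
by rewrite e scale0r add0r subr0.
Qed.

Lemma induced_app_brace_slot D x s1 s2 w : (0 < size w)%N ->
  dpart D (bb x (s1 ++ induced_app w :: s2)) = dpart D (bb x (s1 ++ bb m w :: s2)) -
    (if size w == 1%N then
       sgn R (sdeg w) *: dpart D (bb x (s1 ++ happ (b 1%N) (rcons w m) :: s2)) else 0).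
Proof.
move=> sw; have := @induced_app_slot D _ _ (b (size s1 + size s2).+1) (x :: s1) s2 w sw.
by rewrite /bapp !size_cat /= addnS.
Qed.

(** The brace with x is compatible with the unary operation [-, m] up to the
    operations M'_l. Expanding the left side, m takes k consecutive ys. The terms
    with k = 0, where m stands alone among the ys, are those of b(b(x; ys); m).
    The other terms of b(b(x; ys); m), where m goes into one of the ys, are the
    extra summands of M'_1. *)
Lemma derivation D x ys : D = tag x + sdeg ys + 1 ->
  dpart D (bb (bb x [:: m]) ys) =
  sgn R (sdeg ys) *: dpart D (bb (bb x ys) [:: m]) +
  \sum_(i < (size ys).+1) \sum_(k < (size ys).+1 | (0 < k)%N && (i + k <= size ys)%N)
    sgn R (sdeg (take i ys)) *:
    dpart D (bb x (take i ys ++ induced_app (take k (drop i ys)) :: drop (i + k) ys)).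
Proof.
move=> eD; rewrite brace_single ?m1; last by rewrite eD; ring.
rewrite brace_last // scalerDr.
have sd i : sdeg ys = sdeg (take i ys) + sdeg (drop i ys) by rewrite -sdeg_cat cat_take_drop.
have E1 (i : 'I_(size ys).+1) :
    \sum_(k < (size ys).+1 | (i + k <= size ys)%N) sgn R (1 * sdeg (take i ys)) *:
      dpart D (bb x (take i ys ++ bb m (take k (drop i ys)) :: drop (i + k) ys)) =
    sgn R (sdeg (take i ys)) *: dpart D (bb x (take i ys ++ m :: drop i ys)) +
    \sum_(k < (size ys).+1 | (0 < k)%N && (i + k <= size ys)%N)
      sgn R (sdeg (take i ys)) *:
      dpart D (bb x (take i ys ++ bb m (take k (drop i ys)) :: drop (i + k) ys)).
  rewrite (bigD1 ord0) ?addn0 ?leq_ord //= take0 b_nil ?addn0 mul1r; congr (_ + _).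
  by apply: eq_bigl => k; rewrite andbC lt0n.
rewrite (eq_bigr _ (fun i _ => E1 i)) big_split /= -addrA; congr (_ + _).
  rewrite scaler_sumr; apply: eq_bigr => i _; rewrite sgnZ; congr (_ *: _).
  by apply: sgn_par; rewrite (sd i); parity.
pose T (i : nat) := sgn R (sdeg (take i.+1 ys)) *:
  dpart D (bb x (take i ys ++ happ (b 1%N) (rcons (take 1 (drop i ys)) m) :: drop i.+1 ys)).
have E2 (i : 'I_(size ys).+1) :
    \sum_(k < (size ys).+1 | (0 < k)%N && (i + k <= size ys)%N)
      sgn R (sdeg (take i ys)) *:
      dpart D (bb x (take i ys ++ induced_app (take k (drop i ys)) :: drop (i + k) ys)) =
    \sum_(k < (size ys).+1 | (0 < k)%N && (i + k <= size ys)%N)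
      sgn R (sdeg (take i ys)) *:
      dpart D (bb x (take i ys ++ bb m (take k (drop i ys)) :: drop (i + k) ys)) -
    (if (i < size ys)%N then T i else 0).
  transitivity (\sum_(k < (size ys).+1 | (0 < k)%N && (i + k <= size ys)%N)
    (sgn R (sdeg (take i ys)) *:
      dpart D (bb x (take i ys ++ bb m (take k (drop i ys)) :: drop (i + k) ys)) -
     (if (k == 1 :> nat) && (i < size ys)%N then T i else 0))).
    apply: eq_bigr => k /andP[k0 ik].
    have sz : size (take k (drop i ys)) = k by rewrite size_takel // size_drop; lia.
    rewrite induced_app_brace_slot ?sz // scalerBr; congr (_ - _).
    case: eqP => [k1|_]; last by rewrite scaler0.
    have lin : (i < size ys)%N by lia.
    rewrite lin /T k1 addn1 sgnZ -sdeg_cat; congr (sgn _ (sdeg _) *: _).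
    by rewrite -takeD addn1.
  rewrite sumrB; congr (_ - _); rewrite -big_mkcondr /=.
  case: (ltnP i (size ys)) => lin; last by rewrite big_pred0 // => k; rewrite !andbF.
  have n1 : (1 < (size ys).+1)%N by lia.
  rewrite (big_pred1 (Ordinal n1)) // => k /=; rewrite andbT -val_eqE /=.
  by case: eqP => [->|]; rewrite ?andbF // addn1 lin.
rewrite [in RHS](eq_bigr _ (fun i _ => E2 i)) sumrB addrCA -[LHS]addr0; congr (_ + _).
rewrite big_ord_recr /= ltnn addr0 scaler_sumr.
rewrite -sumrB big1 // => i _; rewrite ltn_ord sgnZ /T.
apply/eqP; rewrite subr_eq0; apply/eqP; congr (_ *: _).
by apply: sgn_par; rewrite (sd i.+1); parity.
Qed.

(** In b(b(z; m); m) the two terms b(z; m, m) come with opposite signs, as m is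
    odd, and the third term contains b(m; m). *)
Lemma bracket_square D z : D = tag z + 1 + 1 -> dpart D (bb (bb z [:: m]) [:: m]) = 0.
Proof.
move=> eD; rewrite brace_single ?m1 ?[sdeg [:: m]]sdeg_cons ?m1 /sdeg ?big_nil ?addr0 //.
rewrite -(sum_pairs 1 (fun i k => sgn R (1 * sdeg (take i [:: m])) *:
  dpart D (bb z (take i [:: m] ++ bb m (take k (drop i [:: m])) :: drop (i + k) [:: m])))).
rewrite big_ord_recl big_ord1 big_ord_recl !big_ord1 /= b_nil.
have -> : dpart D (bb z [:: bb m [:: m]]) = 0.
  have e : tag (bb m [:: m]) = 2 by rewrite tag_bb sdeg_cons m1 /sdeg big_nil.
  have -> : bb m [:: m] = Tagged B (0 : B 2) by rewrite -(part_eq e) mm.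
  exact: (hom_zero (b 1%N) [:: z] [::]).
have e1 : sdeg [:: m] = 1 by rewrite sdeg_cons m1 /sdeg big_nil addr0.
have e0 : sdeg ([::] : seq (hel B)) = 0 by rewrite /sdeg big_nil.
by rewrite e1 e0 mulr0 mulr1 scaler0 addr0 sgn0 /sgn expr1 scale1r scaleN1r subrr.
Qed.

(** The A_oo-relations before the shift. By [derivation] with x = m the terms
    with an outer b(m; -) add up to minus b(b(m; zs); m) with its sign, since
    b(m; m) = 0. The outer b_1(-; m) occurs only when the inner operation takes
    all of zs, and cancels it, up to the term of [bracket_square]. *)
Lemma induced_square D zs : (0 < size zs)%N -> D = 2 + sdeg zs ->
  \sum_(i < (size zs).+1) \sum_(k < (size zs).+1 | (0 < k)%N && (i + k <= size zs)%N)
    sgn R (sdeg (take i zs)) *: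
    dpart D (induced_app (take i zs ++ induced_app (take k (drop i zs)) :: drop (i + k) zs)) = 0.
Proof.
move=> v0 eD.
have E (i k : 'I_(size zs).+1) : (0 < k)%N && (i + k <= size zs)%N ->
  sgn R (sdeg (take i zs)) *:
    dpart D (induced_app (take i zs ++ induced_app (take k (drop i zs)) :: drop (i + k) zs)) =
  sgn R (sdeg (take i zs)) *:
    dpart D (bb m (take i zs ++ induced_app (take k (drop i zs)) :: drop (i + k) zs)) -
  (if (k == size zs :> nat) && (i == 0 :> nat) then
    sgn R (1 + sdeg zs) *: dpart D (happ (b 1%N) [:: induced_app zs; m]) else 0).
  case/andP=> k0 ik; rewrite part_induced_app; last by rewrite size_cat addnS.
  rewrite scalerBr; congr (_ - _).
  have -> : (size (take i zs ++ induced_app (take k (drop i zs)) :: drop (i + k) zs) == 1%N)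
      = (k == size zs :> nat) && (i == 0 :> nat).
    by rewrite size_cat /= size_takel ?size_drop; lia.
  case: andP => [[/eqP -> /eqP ->]|_]; last by rewrite scaler0.
  rewrite take0 drop0 /= add0n take_size drop_size sgnZ; congr (sgn _ _ *: _).
  by rewrite sdeg_cons tag_induced_app /sdeg !big_nil add0r addr0.
under eq_bigr => i _ do rewrite (eq_bigr _ (E i)) sumrB.
rewrite sumrB.
have := @derivation D m zs; rewrite m1 => /(_ _)/esym/eqP; rewrite eD => /(_ ltac:(ring)).
rewrite -eD.
have -> : dpart D (bb (bb m [:: m]) zs) = 0.
  have e : tag (bb m [:: m]) = 2 by rewrite tag_bb sdeg_cons m1 /sdeg big_nil.
  have -> : bb m [:: m] = Tagged B (0 : B 2) by rewrite -(part_eq e) mm.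
  exact: (hom_zero (b (size zs)) [::] zs).
rewrite addrC addr_eq0 => /eqP ->.
rewrite (bigD1 ord0) //= (bigD1 ord_max) /=; last by rewrite v0 leqnn.
rewrite eqxx /= big1; last first.
  by move=> k /andP[_ ne]; rewrite andbT ifN // -[_ == size zs]/(k == ord_max).
rewrite addr0 big1; last first.
  move=> i ne; rewrite big1 // => k _.
  by rewrite ifN // negb_and orbC -[i == 0 :> nat]/(i == ord0) ne.
rewrite addr0.
have := @induced_app_slot D _ _ (b 1%N) [::] [:: m] zs v0; rewrite [[::] ++ _]/= => ->.
rewrite scalerBr opprB addrC -!addrA.
have -> : (if size zs == 1%N then sgn R (sdeg zs) *:
     dpart D (happ (b 1%N) ([::] ++ happ (b 1%N) (rcons zs m) :: [:: m])) else 0) = 0.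
  case: eqP => // sz; case: zs v0 eD E sz => [|z [|z' zs]] // v0 eD _ _.
  rewrite [X in _ *: X](@bracket_square D z) ?scaler0 //.
  by rewrite eD sdeg_cons /sdeg big_nil; ring.
rewrite scaler0 add0r sgnD /= -/(bb _ [:: m]).
have -> : sgn R 1 = -1 by rewrite /sgn expr1.
by rewrite mulN1r scaleNr opprK subrr.
Qed.

Local Notation M := (fun j => shifted (induced b m j)).

Lemma mapp_shS zs :
  mapp M (map (@shS R B) zs) = hscale (sgn R (shift_sign (degs zs))) (shS (induced_app zs)).
Proof. by rewrite /mapp size_map happ_shifted. Qed.

Lemma bapp_hscale a x ys : bb (hscale a x) ys = hscale a (bb x ys).
Proof. exact: (happ_hscale (b (size ys)) [::]). Qed.

Lemma part_mapp D zs :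
  dpart D (mapp M (map (@shS R B) zs)) =
  sgn R (shift_sign (degs zs)) *: dpart (D - 1) (induced_app zs).
Proof. by rewrite mapp_shS part_hscale part_shS. Qed.

Lemma part_bb_mapp D zs ys :
  dpart D (shS (bb (shSinv (mapp M (map (@shS R B) zs))) ys)) =
  sgn R (shift_sign (degs zs)) *: dpart (D - 1) (bb (induced_app zs) ys).
Proof. by rewrite mapp_shS shSinv_scale shSK bapp_hscale part_shS part_hscale. Qed.

Lemma degs_weave o xs c ys :
  degs (weave b o xs c ys) = weave_degs o (degs xs) c (degs ys).
Proof.
elim: xs o c => [|x xs IHxs] o [|[i k] c] /=; try by rewrite /degs map_drop.
rewrite /degs map_cat /= -!/(degs _) IHxs /slice /degs map_take map_drop; congr (_ ++ _ :: _).
by rewrite add0r sdeg_cons sdeg_degs /degs map_take map_drop.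
Qed.

Lemma size_weave o xs c ys : size xs = size c -> (size xs <= size (weave b o xs c ys))%N.
Proof.
elim: xs o c => [|x xs IHxs] o [|[i k] c] //= [/IHxs h].
by rewrite size_cat /= addnS ltnS (leq_trans (h (i + k)%N)) ?leq_addl.
Qed.

(** The outer operations have more than one argument on both sides, so they are
    braces with m, and the two sums have the same index set. *)
Lemma induced_jrel2 : jrel2 b M.
Proof.
move=> xs ys sx /=.
set n := size ys; set D := (X in dpart X _); set X := nth 0 (0 :: degs xs).
set Y := nth 0 (0 :: degs ys).
have appE D' zs : (1 < size zs)%N -> dpart D' (induced_app zs) = dpart D' (bb m zs).
  by move=> h; rewrite part_induced_app ?(ltnW h) // ifN ?subr0 // neq_ltn h orbT.
rewrite part_bb_mapp.
have -> : dpart (D - 1) (bb (induced_app xs) ys) = dpart (D - 1) (bb (bb m xs) ys).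
  have := @induced_app_slot (D - 1) _ _ (b (size ys)) [::] ys xs (ltnW sx).
  by rewrite ifN ?subr0 // neq_ltn sx orbT.
rewrite brace_at; last by rewrite /D m1; lia.
rewrite !scaler_sumr; apply: eq_bigr => c hc.
have sc : size xs = size (places c) by rewrite size_map size_tuple.
rewrite part_mapp appE; last by apply: leq_trans sx (size_weave _ _ sc).
rewrite !sgnZ; congr (_ *: _); apply: sgn_par.
have sc' : size (degs xs) = size (places c) by rewrite size_map.
have hc' : insertion 1 (size (degs ys)) (places c) by rewrite size_map.
have := par_jeps2 sc' hc'; have := par_weave_degs (ltn0Sn 0) sc' hc'.
rewrite !size_map -degs_weave drop0 take0 isum_nil mulr0 addr0 => e1 e2.
have := jlhs_signE (degs ys); rewrite size_map => ->.
rewrite parD [in RHS]parD e1 e2.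
have -> : \sum_(p < size xs) (degs xs)`_p * sdeg (take (nth 0%N (unzip1 (places c)) p).-1 ys) =
    \sum_(p < size xs) (degs xs)`_p * isum (take (nth 0%N (unzip1 (places c)) p).-1 (degs ys)).
  by apply: eq_bigr => p _; rewrite sdeg_degs /degs map_take.
set ep := \sum_(p < size xs) _.
parity.
Qed.

(** The first sum on the right is b(b(m; x); ys) except for the summand with one
    single entry, where M'_1 has the extra term b(b(x; ys); m). On the left M'_1(x)
    has the extra term b(x; m). The two extra terms and the second sum on the
    right are related by [derivation]. *)
Lemma induced_jrel1 : jrel1 b M.
Proof.
move=> x ys /=; set n := size ys; set D := tag x + sdeg ys + 2; set Y := nth 0 (0 :: degs ys).
set s := shift_sign (degs ys).
have sY : jlhs_sign n Y = s by have := jlhs_signE (degs ys); rewrite size_map.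
(* The degrees of the ys before, in and after a segment of length k. *)
have split3 i k (a := take i ys) (u := take k (drop i ys)) (c := drop (i + k) ys) :
    (i + k <= n)%N -> [/\ degs ys = degs a ++ degs u ++ degs c,
      n = size (degs a ++ degs u ++ degs c), size (degs a) = i & size (degs u) = k].
  move=> ik; have eys : degs ys = degs a ++ degs u ++ degs c.
    by rewrite /degs -!map_cat /c addnC -drop_drop !cat_take_drop.
  by rewrite -eys !size_map !size_takel ?size_drop //; rewrite -/n; lia.
pose G1 i k := sgn R (s + tag x * sdeg (take i ys)) *:
  dpart (D - 1) (induced_app (take i ys ++ bb x (take k (drop i ys)) :: drop (i + k) ys)).
have E1 : \sum_(0 <= k < n.+1) \sum_(1 <= i < (n - k).+2)
    sgn R (jeps1 n k i (tag x) Y) *: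
    dpart D (mapp M [seq shS z | z <- weave b 1 [:: x] [:: (i, k)] ys]) =
  \sum_(i < n.+1) \sum_(k < n.+1 | (i + k <= n)%N) G1 i k.
  rewrite -[RHS](sum_pairs_nat n G1 0); apply: eq_big_nat => k /andP[_ kn].
  apply: eq_big_nat => -[|i] // /andP[_ ik]; rewrite [i.+1.-1]/=.
  have /split3 [eys en sa su] : (i + k <= n)%N by lia.
  have -> : weave b 1 [:: x] [:: (i.+1, k)] ys =
      take i ys ++ bb x (take k (drop i ys)) :: drop (i + k) ys.
    by rewrite /= /slice subn1 /= drop0.
  rewrite part_mapp sgnZ /G1; congr (_ *: _); apply: sgn_par.
  have := par_jeps1 (degs (take i ys)) (degs (take k (drop i ys))) (degs (drop (i + k) ys)) (tag x).
  by rewrite -en -eys sa su [degs (_ ++ _)]map_cat /= add0r sdeg_cons !sdeg_degs.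
pose G2 i k := sgn R (s + sdeg (take i ys)) *:
  dpart (D - 1) (bb x (take i ys ++ induced_app (take k (drop i ys)) :: drop (i + k) ys)).
have E2 : \sum_(1 <= l < n.+1) \sum_(1 <= i < (n - l).+2)
      sgn R (jeta n l i Y) *:
      dpart D (shS (bapp b x (take i.-1 ys ++
        shSinv (mapp M [seq shS z | z <- slice i l ys]) :: drop (i.-1 + l)%N ys))) =
  \sum_(i < n.+1) \sum_(k < n.+1 | (0 < k)%N && (i + k <= n)%N) G2 i k.
  rewrite -[RHS](sum_pairs_nat n G2 1); apply: eq_big_nat => k /andP[k0 kn].
  apply: eq_big_nat => -[|i] // /andP[_ ik]; rewrite [i.+1.-1]/= /slice [i.+1.-1]/=.
  have /split3 [eys en sa su] : (i + k <= n)%N by lia.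
  rewrite mapp_shS shSinv_scale shSK.
  have -> : forall e s1 y s2, bb x (s1 ++ hscale e y :: s2) = hscale e (bb x (s1 ++ y :: s2)).
    by move=> e s1 y s2; rewrite /bapp !size_cat /=; exact: (happ_hscale _ (x :: s1)).
  rewrite part_shS part_hscale sgnZ /G2; congr (_ *: _); apply: sgn_par.
  have := par_jeta (degs (take i ys)) (degs (take k (drop i ys))) (degs (drop (i + k) ys)).
  by rewrite -en -eys sa su sdeg_degs.
rewrite {}E1 {}E2 -[[:: shS x]]/(map (@shS R B) [:: x]) part_bb_mapp sY.
rewrite /= mul0r addr0 sgn0 scale1r.
have eD : D - 1 = tag x + sdeg ys + 1 by rewrite /D; lia.
have -> : dpart (D - 1) (bb (induced_app [:: x]) ys) = dpart (D - 1) (bb (bb m [:: x]) ys)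
    - sgn R (tag x) *: dpart (D - 1) (bb (bb x [:: m]) ys).
  have := @induced_app_slot (D - 1) _ _ (b (size ys)) [::] ys [:: x] isT.
  by rewrite /= sdeg_cons /sdeg big_nil addr0.
rewrite brace_single; last by rewrite eD m1; ring.
rewrite derivation //.
have E1 (i k : 'I_n.+1) : (i + k <= n)%N ->
  G1 i k = sgn R (s + tag x * sdeg (take i ys)) *:
    dpart (D - 1) (bb m (take i ys ++ bb x (take k (drop i ys)) :: drop (i + k) ys)) -
   (if (k == n :> nat) && (i == 0 :> nat) then
     sgn R (s + tag x + sdeg ys) *: dpart (D - 1) (bb (bb x ys) [:: m]) else 0).
  move=> ik; rewrite /G1 part_induced_app; last by rewrite size_cat addnS.
  rewrite scalerBr; congr (_ - _).
  have -> : (size (take i ys ++ bb x (take k (drop i ys)) :: drop (i + k) ys) == 1%N)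
      = (k == n :> nat) && (i == 0 :> nat).
    by rewrite size_cat /= size_takel ?size_drop -/n; lia.
  case: andP => [[/eqP -> /eqP ->]|_]; last by rewrite scaler0.
  rewrite take0 drop0 add0n take_size drop_size sgnZ sdeg_cons tag_bb.
  have e0 : sdeg ([::] : seq (hel B)) = 0 by rewrite /sdeg big_nil.
  by rewrite e0 mulr0 !addr0 addrA.
under [X in _ = X - _]eq_bigr => i _ do rewrite (eq_bigr _ (E1 i)) sumrB.
rewrite sumrB.
rewrite [X in _ = _ - X - _](_ : _ = sgn R (s + tag x + sdeg ys) *:
  dpart (D - 1) (bb (bb x ys) [:: m])); last first.
  rewrite (bigD1 ord0) //= (bigD1 ord_max) /=; last by rewrite leqnn.
  rewrite eqxx /= big1; last first.
    by move=> k /andP[_ ne]; rewrite andbT ifN.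
  rewrite addr0 big1; last first.
    move=> i ne; rewrite big1 // => k _.
    by rewrite ifN // negb_and orbC -[i == 0 :> nat]/(i == ord0) ne.
  by rewrite addr0.
rewrite scalerBr -[RHS]addrA; congr (_ + _).
  rewrite scaler_sumr; apply: eq_bigr => i _; rewrite scaler_sumr; apply: eq_bigr => k _.
  by rewrite sgnZ.
rewrite scalerDr sgnZ scalerDr sgnZ opprD; congr (- _ - _).
  by rewrite addrA.
rewrite !scaler_sumr; apply: eq_bigr => i _; rewrite !scaler_sumr; apply: eq_bigr => k _.
rewrite /G2 !sgnZ; congr (sgn _ _ *: _); ring.
Qed.

Lemma opart_hom (V : gmod R) n k v e (f : ghom V n k) xs : n = v -> k = e ->
  (opart (EndA V) v e (oelt (P := EndA V) f) : ghom V v e) xs =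
  dpart (e + sdeg xs) (happ f xs).
Proof.
move=> en ek; subst v e.
by rewrite (partE (V := oarp (EndA V)) (i := (n, k))) /happ partE.
Qed.

Lemma hom_sumE (V : gmod R) n k (I : Type) (r : seq I) (p : pred I) (F : I -> ghom V n k) xs :
  (\sum_(i <- r | p i) F i : ghom V n k) xs = \sum_(i <- r | p i) F i xs.
Proof. by elim/big_rec2: _ => // i y1 y2 _ <-. Qed.

Lemma induced_ainf : ainf_algebra M.
Proof.
split.
  apply: hom_ext => xs; rewrite [RHS](_ : _ = 0) //.
  have [sx|sx] := eqVneq (size xs) 0%N; last exact: (proj1 (hom_multilinear _)).
  rewrite -[LHS](partE (V := gshift B)) -/(happ _ xs).
  rewrite -(mapK (@shSinvK R B) xs) happ_shifted ?size_map // part_hscale part_shS.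
  by rewrite /happ /= part0 scaler0.
move=> v v0; apply: hom_ext => xs; rewrite [RHS](_ : _ = 0) //.
have [sx|sx] := eqVneq (size xs) v; last exact: (proj1 (hom_multilinear _)).
pose zs := map (@shSinv R B) xs.
have sz : size zs = v by rewrite size_map.
have exs : xs = map (@shS R B) zs by rewrite mapK //; exact: shSinvK.
pose T := 3 - v%:Z + sdeg xs.
have eT : T - 1 = 2 + sdeg zs by rewrite /T exs sdeg_shS sz; lia.
transitivity (sgn R (shift_sign (degs zs)) *:
  \sum_(i < (size zs).+1) \sum_(k < (size zs).+1 | (0 < k)%N && (i + k <= size zs)%N)
    sgn R (sdeg (take i zs)) *:
    dpart (T - 1) (induced_app
      (take i zs ++ induced_app (take k (drop i zs)) :: drop (i + k) zs))); last first.
  by rewrite induced_square ?sz // scaler0.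
rewrite hom_sumE scaler_sumr sz; apply: eq_bigr => r _.
rewrite hom_sumE scaler_sumr; apply: eq_bigr => q /andP[q0 rq].
rewrite [LHS](_ : _ = sgn R (r * q + (v - r - q))%N *:
   ((opart (EndA (gshift B)) v (3 - v%:Z) (oelt (P := EndA (gshift B))
      (end_circ r (M (r + 1 + (v - r - q))%N) (M q)))) : ghom (gshift B) v (3 - v%:Z)) xs) //.
rewrite opart_hom; [|lia|lia].
rewrite -/T happ_circ part_hscale exs -map_take -map_drop -map_take -map_drop.
rewrite happ_shifted; last by rewrite size_takel // size_drop sz; lia.
rewrite happ_hscale part_hscale.
have sq : size (take q (drop r zs)) = q by rewrite size_takel // size_drop sz; lia.
have -> : shS (happ (induced b m q) (take q (drop r zs))) =
    shS (induced_app (take q (drop r zs))).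
  by rewrite /induced_app sq.
rewrite -map_cons -map_cat.
have sw : size (take r zs ++ induced_app (take q (drop r zs)) :: drop (r + q) zs) =
    (r + 1 + (v - r - q))%N.
  by rewrite size_cat /= size_takel ?size_drop ?sz; lia.
rewrite happ_shifted // part_hscale part_shS.
rewrite -[in X in dpart _ X]sw -/(induced_app _) !sgnZ; congr (_ *: _); apply: sgn_par.
have := par_ainf (degs (take r zs)) (degs (take q (drop r zs))) (degs (drop q (drop r zs))).
rewrite /degs -!map_cat !cat_take_drop !size_map sq -!/(degs _) -!sdeg_degs.
have -> : size (take r zs) = r by rewrite size_takel // sz; lia.
have -> : (size (drop q (drop r zs)) = v - r - q)%N by rewrite !size_drop sz.
rewrite sdeg_shS size_takel ?sz; last by lia.
rewrite [degs (_ ++ _)]map_cat /= drop_drop [(q + r)%N]addnC -!/(degs _).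
move=> e; rewrite -e; congr par; ring.
Qed.

Theorem induced_J_algebra : J_algebra b M.
Proof.
split; [exact: induced_ainf | exact: bA | exact: induced_jrel1 | exact: induced_jrel2].
Qed.

End BraceAlgebraWithSquareZero.

(** * Multiplications as square-zero elements *)

Section OperadBraces.
Variables (R : comPzRingType) (P : operad_data R).
Hypothesis axP : operad_axioms P.

Lemma scan_nil p n (z : oel P) : scan p n z [::] = [:: z].
Proof. by elim: n p => [|n IHn] p //=; rewrite IHn. Qed.

Lemma scan_single (V : zmodType) (F : oel P -> V) p n z y :
  \sum_(v <- scan p n z [:: y]) F v = \sum_(r < n) \sum_(a <- y.2) F (circ (p + r) z a).
Proof.
elim: n p => [|n IHn] p; first by rewrite big_ord0 /= big_nil.
rewrite scan_sumS IHn big_ord_recl addrC addn0; congr (_ + _).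
  by apply: eq_bigr => a _; rewrite scan_nil big_seq1.
by apply: eq_bigr => r _; rewrite lift0 addnS.
Qed.

Lemma bapp_nil x : bapp (brace P) x [::] = x.
Proof.
case: x => d x; pose h : hel (tot P) := Tagged (tot P) x; rewrite -/h.
have e : tag (bapp (brace P) h [::]) = d by rewrite tag_bb /sdeg big_nil addr0.
rewrite -(part_eq e) -[RHS](part_eq (V := tot P) (x := h) (erefl : tag h = d)); congr (Tagged _ _).
apply: functional_extensionality_dep => N.
rewrite (@bapp_represents _ _ axP _ _ _ _ (truncate N.+1 h) [::]) //; last first.
  by apply: represents_truncate; rewrite addn0.
case: (represents_truncate h (ltnSn N)) => [_ _ /(_ N (leqnn N)) eN].
rewrite partE -[RHS]/((tagged h : dprod _) N) -eN; apply: eq_bigr => z _.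
by rewrite scan_nil big_seq1.
Qed.

Lemma bapp_square (mu : tot P 1) (D : int) : (forall N, square mu N = 0) ->
  dpart D (bapp (brace P) (Tagged (tot P) mu) [:: Tagged (tot P) mu]) = 0.
Proof.
move=> sq; set m := Tagged (tot P) mu.
have [<-|ne] := eqVneq (1 + 1) D; last first.
  by rewrite part_ne // tag_bb sdeg_cons /sdeg big_nil addr0.
apply: functional_extensionality_dep => N.
rewrite (@bapp_represents _ _ axP _ _ _ _ (truncate N.+2 m) [:: truncate N.+1 m]) //; first last.
- by split=> //; apply: represents_truncate.
- by apply: represents_truncate; rewrite addn1.
rewrite -[RHS](sq N) /square big_truncate; apply: eq_bigr => a _.
rewrite exchange_big scan_single; apply: eq_bigr => r _.
by rewrite big_truncate.
Qed.

End OperadBraces.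

Lemma circ0r (R : comPzRingType) (P : operad_data R) r x n d :
  circ r x (oelt (0 : P n d)) = oelt (0 : P (arity x + n).-1%N (degree x + d)).
Proof. by rewrite /circ; congr (oelt _); apply: ocirc0r. Qed.

Lemma opart0 (R : comPzRingType) (P : operad_data R) n d n' d' :
  opart P n' d' (oelt (0 : P n d)) = 0 :> P n' d'.
Proof. exact: (@part0 _ _ (oarp P) (n, d) (n', d')). Qed.

Lemma opart_susp (R : comPzRingType) (P : operad_data R) n d (x : oel (susp P)) :
  tag x = (n, d) -> opart (susp P) n d x = opart P n (d + 1 - n%:Z) (unsusp x).
Proof.
case: x => -[n' d'] x /= [e1 e2]; subst n' d'.
rewrite (partE (V := oarp (susp P)) (i := (n, d))).
by rewrite (partE (V := oarp P) (i := (n, d + 1 - n%:Z))).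
Qed.

(** The arity N of m ~o m is a sum over pairs of arities a, b with a + b = N + 1.
    For b = q and a = r + 1 + t the sign of the suspension is
    (r + t) + r (q - 1), which has the parity of r q + t. *)
Lemma ainf_sum_multiplication (R : comPzRingType) (A : gmod R)
  (m : forall j, ghom A j (2 - j%:Z)) :
  ainf_algebra m -> ainf_multiplication (ainf_sum m).
Proof.
case=> m0 hm; split=> // N.
set mu := Tagged (tot (susp (EndA A))) (ainf_sum m).
pose T a b r : ghom A N (3 - N%:Z) := opart (EndA A) N (3 - N%:Z)
  (circ (P := EndA A) r (oelt (P := EndA A) (m a)) (oelt (P := EndA A) (m b))).
have E (a : 'I_N.+2) (b : 'I_N.+1) (r : 'I_a) :
    opart (susp (EndA A)) N (1 + 1) (circ r (ar a mu) (ar b mu)) =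
    if (0 < b)%N && (a == N.+1 - b :> nat)%N then
      sgn R ((a%:Z - 1) + r%:Z * (b%:Z - 1)) *: T a b r else 0.
  have ra := ltn_ord r.
  case: (posnP b) => [b0|b0] /=.
    have -> : ar b mu = oelt (0 : susp (EndA A) b 1).
      by rewrite /ar /= b0; congr (oelt _); exact: m0.
    rewrite circ0r; exact (@opart0 R (susp (EndA A)) _ _ N (1 + 1)).
  case: eqP => [ea|ne]; last first.
    have neq : tag (circ r (ar a mu) (ar b mu)) != (N, 1 + 1).
      by apply/eqP => -[]; rewrite /=; lia.
    exact (@opart_ne R (susp (EndA A)) N (1 + 1) _ neq).
  have et : tag (circ r (ar a mu) (ar b mu)) = (N, 1 + 1) by rewrite /=; congr (_, _); lia.
  have := @opart_susp R (EndA A) N (1 + 1) _ et; rewrite unsusp_circ // => H.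
  refine (etrans H _).
  refine (etrans (@part_scale R _ (oarp (EndA A)) _ (N, 1 + 1 + 1 - N%:Z) _ _) _).
  by rewrite [degree _]/= mulr1.
rewrite /square exchange_big /=.
case: (posnP N) => [N0|Npos].
  rewrite big1 // => b _; rewrite big1 // => a _; rewrite big1 // => r _; rewrite E ifN //.
  by have := ltn_ord b; lia.
pose F r q := sgn R (((N.+1 - q)%N%:Z - 1) + r%:Z * (q%:Z - 1)) *: T (N.+1 - q)%N q r.
transitivity (\sum_(r < N.+1) \sum_(q < N.+1 | (0 < q)%N && (r + q <= N)%N) F r q).
  rewrite (exchange_big_dep (fun q : 'I_N.+1 => (0 < q)%N)) /=; last by move=> r q _ /andP[].
  rewrite [RHS]big_mkcond; apply: eq_bigr => q _.
  have hq : (N.+1 - q < N.+2)%N by rewrite ltnS leq_subr.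
  rewrite (bigD1 (Ordinal hq)) //= [X in _ + X = _]big1 ?addr0; last first.
    move=> a ne; rewrite big1 // => r _; rewrite E ifN // negb_and orbC.
    by rewrite -[_ == (N.+1 - q)%N]/(a == Ordinal hq) ne.
  case: posnP => q0.
    rewrite big1 // => r _; rewrite (E (Ordinal hq)) ifN // negb_and -eqn0Ngt.
    by apply/orP; left; apply/eqP.
  transitivity (\sum_(r < N.+1 - q) F r q).
    by apply: eq_bigr => r _; rewrite (E (Ordinal hq)) q0 eqxx.
  rewrite (big_ord_widen N.+1 (fun r => F r q)) ?leq_subr //.
  by apply: eq_bigl => r; have := ltn_ord q; lia.
rewrite -[RHS](hm N Npos); apply: eq_bigr => r _; apply: eq_bigr => q /andP[q0 rq].
cbv zeta.
have -> : (r + 1 + (N - r - q) = N.+1 - q)%N by lia.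
rewrite /F /T; congr (_ *: _); apply: sgn_par.
have -> : (N.+1 - q)%N%:Z - 1 = r%:Z + (N - r - q)%N%:Z by lia.
by rewrite PoszD PoszM; parity.
Qed.

(** * Hochschild complexes *)

Theorem theoremB (R : comPzRingType) :
  (forall (O : operad R) (m : tot (susp O) 1%R),
     ainf_multiplication m -> hochschild_J_algebra (inducedM m)) /\
  (forall (A : gmod R) (m : forall j : nat, ghom A j (2 - j%:Z)%R),
     ainf_algebra m -> hochschild_J_algebra m).
Proof.
have hochschild (A : gmod R) (m : forall j, ghom A j (2 - j%:Z)) :
    ainf_algebra m -> hochschild_J_algebra m.
  move=> /ainf_sum_multiplication[_ sq].
  have ax := susp_axioms (operadP (EndA A)).
  apply: (@induced_J_algebra R _ _ (Tagged (tot (susp (EndA A))) (ainf_sum m))) => //.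
  - exact: brace_brace_algebra.
  - exact: bapp_nil.
  - by move=> D; apply: bapp_square.
split=> // O m [_ sq]; apply: hochschild.
have ax := susp_axioms (operadP O).
apply: (@induced_ainf R _ _ (Tagged (tot (susp O)) m)) => //.
- exact: brace_brace_algebra.
- exact: bapp_nil.
- by move=> D; apply: bapp_square.
Qed.
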